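(* Let $0\le\beta<1$, $0\le\beta'<1$, $\kappa>0$, $\epsilon\in\mathbb{R}$, and let $(\mathbf{x}_t)_{t\ge0}$ be generated from a deterministic $\mathbf{x}_0\in\mathbb{R}^d$ by the perturbed Adam algorithm $$\begin{aligned} v_t&=\beta' v_{t-1}+(1-\beta')\Vert\mathbf{g}_{t-1}\Vert^2\quad(t\ge1),\\ \mathbf{m}_{t+1}&=\beta\mathbf{m}_t-\frac{1-\beta}{(t+1)^{1/2+\epsilon}(\kappa+v_t^{1/2})}\,\mathbf{g}_t,\\ \mathbf{x}_{t+1}&=\mathbf{x}_t+\mathbf{m}_{t+1}\qquad(t\ge0),\end{aligned}$$ with $v_0=0$, $\mathbf{m}_0=0$ and $\mathbf{g}_t=\mathbf{g}(\mathbf{x}_t,\xi_t)$. Assume (A.1), (A.2), (A.3) and (A.5) listed in the context. Suppose that $\frac{1}{1+\alpha}-\frac12<\epsilon\le\frac12$ and that there exists a constant $G>0$ such that $\Vert\nabla f(\mathbf{x}_t)\Vert\le G$ and $\Vert\mathbf{g}_t\Vert\le G$ for every $t$. Then, almost surely, $\nabla f(\mathbf{x}_t)$ converges to zero and $f(\mathbf{x}_t)$ converges. Moreover, $\liminf_{t\to\infty}t^{1/2-\epsilon}\Vert\nabla f(\mathbf{x}_t)\Vert^2=0$ with probability $1$.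
   Context: $\Vert\cdot\Vert$ is the Euclidean norm on $\mathbb{R}^d$. $f:\mathbb{R}^d\to\mathbb{R}$ is the cost function. $\mathbf{g}(\mathbf{x},\xi)$ is a stochastic first order oracle: $\mathbf{g}$ is a Borel measurable $\mathbb{R}^d$-valued function, and $\xi_0,\xi_1,\dots$ are random variables on a probability space $(\Omega,\mathcal{F},\mathbb{P})$ with which the oracle is queried (pathwise: $\mathbf{g}_t(\omega)=\mathbf{g}(\mathbf{x}_t(\omega),\xi_t(\omega))$). Assumptions: (A.1) $f$ is continuously differentiable and $f_*:=\inf_{\mathbf{x}}f(\mathbf{x})>-\infty$. (A.2) There exist $\alpha\in(0,1]$ and $A>0$ such that $\Vert\nabla f(\mathbf{x})-\nabla f(\mathbf{y})\Vert\le A\Vert\mathbf{x}-\mathbf{y}\Vert^\alpha$ for all $\mathbf{x},\mathbf{y}\in\mathbb{R}^d$. This $\alpha$ is the one in the condition on $\epsilon$. (A.3) $\mathbb{E}[\mathbf{g}(\mathbf{x},\xi)]=\nabla f(\mathbf{x})$ for all $\mathbf{x}\in\mathbb{R}^d$, for $\xi$ each of the $\xi_t$. (A.5) The random variables $\{\xi_t\}_{t\ge0}$ are independent of each other. *)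

(* Defs.v *)
From HB Require Import structures.
From mathcomp Require Import all_boot all_order all_algebra finmap.
From mathcomp Require Import all_classical all_reals all_analysis.
Set Implicit Arguments.
Unset Strict Implicit.
Unset Printing Implicit Defensive.
Import Order.TTheory GRing.Theory Num.Theory numFieldNormedType.Exports.
Local Open Scope classical_set_scope.
Local Open Scope ring_scope.

(* The norm [`|x|] that the library puts on ['rV[R]_n] is the maximum norm.
   It induces the same topology as [enorm], so [continuous], [differentiable],
   [open] and limits have their usual meaning on R^n. *)
Definition enorm (R : realType) (n : nat) (x : 'rV[R]_n) : R :=
  Num.sqrt (\sum_(i < n) x ord0 i ^+ 2).

(* The total operator ['D_v f x] is a genuine partial derivative only where [f]
   is derivable, hence the differentiability clause of [C1] below. *)
Definition grad (R : realType) (n : nat) (f : 'rV[R]_n -> R) (x : 'rV[R]_n) :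
    'rV[R]_n :=
  \row_(i < n) 'D_(delta_mx ord0 i) f x.

Definition C1 (R : realType) (n : nat) (f : 'rV[R]_n -> R) : Prop :=
  (forall x, differentiable f x) /\ continuous (grad f).

(* R^n with its Borel sigma-algebra; convertible to ['rV[R]_n]. *)
Definition borel_rV (R : realType) (n : nat) :=
  g_sigma_algebraType (@open 'rV[R]_n).

Definition mutually_independent (d : measure_display) (T : measurableType d)
    (R : realType) (P : probability T R) (d' : measure_display)
    (T' : measurableType d') (I : choiceType) (X : I -> {RV P >-> T'}) : Prop :=
  forall (J : {fset I}) (A : I -> set T'),
    (forall i, measurable (A i)) ->
    P (\bigcap_(i in [set` J]) (X i @^-1` A i)) =
    (\prod_(i <- J) P (X i @^-1` A i))%E.

(* Vector expectation E[Y] = mu, read coordinatewise; integrability is part of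
   the claim because the library integral is total. *)
Definition has_mean (d : measure_display) (T : measurableType d)
    (R : realType) (P : probability T R) (n : nat) (Y : T -> 'rV[R]_n)
    (mu : 'rV[R]_n) : Prop :=
  forall i : 'I_n,
    P.-integrable setT (EFin \o (fun w => Y w ord0 i)) /\
    ('E_P[fun w => Y w ord0 i] = (mu ord0 i)%:E)%E.

(* Pathwise recursion; [g t] is the oracle output at time [t], and the line
   defining v_t for t >= 1 is shifted by one. *)
Record perturbed_adam (R : realType) (n : nat) (beta beta' kappa eps : R)
    (x0 : 'rV[R]_n) (g : nat -> 'rV[R]_n)
    (v : nat -> R) (m x : nat -> 'rV[R]_n) : Prop := PerturbedAdam {
  adam_v0 : v 0%N = 0 ;
  adam_m0 : m 0%N = 0 ;
  adam_x0 : x 0%N = x0 ;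
  adam_v : forall t, v t.+1 = beta' * v t + (1 - beta') * enorm (g t) ^+ 2 ;
  adam_m : forall t, m t.+1 = beta *: m t -
    ((1 - beta) / (t.+1%:R `^ (1 / 2 + eps) * (kappa + Num.sqrt (v t)))) *: g t ;
  adam_x : forall t, x t.+1 = x t + m t.+1
}.

(* Main.v *)
Require Import Defs.
From HB Require Import structures.
From mathcomp Require Import all_boot all_order all_algebra finmap.
From mathcomp Require Import all_classical all_reals all_analysis.
From mathcomp Require Import measurable_realfun.
From mathcomp Require Import ring lra.
Import Order.TTheory GRing.Theory Num.Theory numFieldNormedType.Exports.
Local Open Scope classical_set_scope.
Local Open Scope ring_scope.

(* With [c = beta / (1 - beta)], the shifted iterate [z_t = x_t + c m_t] performs
   the plain stochastic gradient step [z_(t+1) = z_t - a_t g_t], where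
   [a_t = (t+1)^-(1/2+eps) / (kappa + sqrt v_t)] depends only on the past.
   Convexity of [s |-> s^(1+alpha)] bounds [sum |m_t|^(1+alpha)] by a multiple of
   [sum a_t^(1+alpha) < oo], so z is close to x and the Hoelder descent inequality
   reads [f(z_(t+1)) = f(z_t) - a_t |grad f(x_t)|^2 - (noise) + (summable)].
   The noise is a martingale series with square-summable increments, hence
   converges almost surely; this gives the convergence of f(x_t) and
   [sum a_t |grad f(x_t)|^2 < oo], hence the liminf since
   [sum 1/t] diverges.  Between two times at which |grad f| crosses from below d
   to above 2 d the iterate must move by a fixed amount, which these convergences
   forbid at late times; so grad f(x_t) tends to 0. *)

(** * Real series and powers *)

Section powR_facts.
Context {R : realType}.
Implicit Types a b p q s : R.

(** Discrete form of the comparison of [x^-(1+s)] with its primitive. Dividing by [(t+2)^-s] and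
    putting [y = (t+1)/(t+2)] leaves [s (1 - y) <= y^-s - 1], which follows from [exp u >= 1 + u]
    and [ln y <= y - 1]. *)
Lemma powR_riemann_step s (t : nat) : 0 < s ->
  s * t.+2%:R `^ (- (1 + s)) <= t.+1%:R `^ (- s) - t.+2%:R `^ (- s).
Proof.
move=> s0; have t2 : 0 < t.+2%:R :> R by [].
pose y : R := t.+1%:R / t.+2%:R.
have y0 : 0 < y by rewrite divr_gt0.
have yE : 1 - y = t.+2%:R^-1.
  by rewrite /y -{1}(divff (lt0r_neq0 t2)) -mulrBl -natrB// subSnn mul1r.
have -> : t.+1%:R `^ (- s) = t.+2%:R `^ (- s) * y `^ (- s).
  by rewrite -powRM ?ltW// /y mulrC divfK// lt0r_neq0.
have -> : t.+2%:R `^ (- (1 + s)) = t.+2%:R `^ (- s) * t.+2%:R^-1.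
  by rewrite opprD powRD ?powR_inv1 1?mulrC// lt0r_neq0// implybT.
rewrite mulrCA -[X in _ <= _ - X]mulr1 -mulrBr ler_pM2l ?powR_gt0//.
rewrite lerBrDl /powR gt_eqF// (le_trans _ (expR_ge1Dx _))// lerD2l -yE.
rewrite mulNr -mulrN ler_pM2l// -[1 - y]opprB lerN2.
by have := le_ln1Dx (x := y - 1); rewrite [1 + _]addrC subrK; apply; rewrite ltrBrDr addNr.
Qed.

Lemma cvg_series_powR p : 1 < p -> cvgn (series (fun t : nat => t.+1%:R `^ (- p))).
Proof.
move=> p1; pose s := p - 1.
have s0 : 0 < s by rewrite subr_gt0.
have pE : p = 1 + s by rewrite /s addrC subrK.
apply: nondecreasing_is_cvgn.
  by apply/nondecreasing_seqP => n; rewrite /series/= big_nat_recr//= lerDl powR_ge0.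
exists (1 + s^-1) => _ [n _ <-]; rewrite /series/=.
have step k : k.+2%:R `^ (- p) <= s^-1 * (k.+1%:R `^ (- s) - k.+2%:R `^ (- s)) :> R.
  by rewrite -ler_pdivrMl ?invr_gt0// invrK pE powR_riemann_step.
(* The telescoped remainder stays in the bound so that the induction closes; it is dropped only at
   the end. *)
have h k : \sum_(0 <= t < k.+1) t.+1%:R `^ (- p) <= 1 + s^-1 * (1 - k.+1%:R `^ (- s)) :> R.
  elim: k => [|k IH]; first by rewrite big_nat1 !powR1 subrr mulr0 addr0.
  rewrite big_nat_recr//= (le_trans (lerD IH (step k)))//.
  by rewrite -addrA -mulrDr addrA subrK.
have si : 0 <= s^-1 by rewrite invr_ge0 ltW.
case: n => [|k]; first by rewrite big_geq// addr_ge0.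
rewrite (le_trans (h k))// lerD2l ler_piMr// gerBl powR_ge0//.
Qed.

(** A crude Young inequality: the product is at most the power [1 + p] of the larger of [a] and [b].
    It separates step size from momentum in the descent error. *)
Lemma mul_powR_le a b p : 0 <= a -> 0 <= b -> 0 < p ->
  a * b `^ p <= a `^ (1 + p) + b `^ (1 + p).
Proof.
move=> a0 b0 p0; have p1 : 0 < 1 + p by rewrite addr_gt0.
have powS c : 0 <= c -> c `^ (1 + p) = c * c `^ p.
  move=> c0; rewrite powRD ?powRr1//; apply/implyP => /eqP h.
  by move: p1; rewrite h ltxx.
have [ab|/ltW ba] := leP a b.
  rewrite (@le_trans _ _ (b `^ (1 + p)))// ?lerDr ?powR_ge0// powS//.
  by rewrite ler_wpM2r// powR_ge0.
rewrite (@le_trans _ _ (a `^ (1 + p)))// ?lerDl ?powR_ge0// powS//.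
by rewrite ler_wpM2l// ge0_ler_powR// ?ltW// nnegrE.
Qed.

Lemma powR_convex2 (t a b q : R) : 1 <= q -> 0 <= t <= 1 -> 0 <= a -> 0 <= b ->
  (t * a + (1 - t) * b) `^ q <= t * a `^ q + (1 - t) * b `^ q.
Proof.
move=> q1 t01 a0 b0.
have := convex_powR q1 (Itv01 (andP t01).1 (andP t01).2) (x := a) (y := b).
rewrite !inE/= !in_itv/= !andbT a0 b0 => /(_ erefl erefl).
by rewrite !convRE.
Qed.

End powR_facts.

Section real_series.
Context {R : realType}.
Implicit Types u v p w y a : nat -> R.

Lemma nneg_series_cvg u C : (forall t, 0 <= u t) ->
  (forall k, \sum_(0 <= t < k) u t <= C) -> cvgn (series u).
Proof.
move=> u0 uC; apply: nondecreasing_is_cvgn.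
  by apply/nondecreasing_seqP => k; rewrite /series/= big_nat_recr//= lerDl.
by exists C => _ [k _ <-]; exact: uC.
Qed.

Lemma cvg_nneg_series_ub u : (forall t, 0 <= u t) -> cvgn (series u) ->
  exists C, forall k, \sum_(0 <= t < k) u t <= C.
Proof.
move=> u0 cu; exists (limn (series u)) => k.
apply: (@nondecreasing_cvgn_le _ (series u)) => //.
by apply/nondecreasing_seqP => j; rewrite /series/= big_nat_recr//= lerDl.
Qed.

Lemma near_series_le_cvg u v T : (forall t, 0 <= u t) -> (forall t, 0 <= v t) ->
  (forall t, (T <= t)%N -> u t <= v t) -> cvgn (series v) -> cvgn (series u).
Proof.
move=> u0 v0 uv /(cvg_nneg_series_ub _ v0)[C vC].
have nd k : (k <= T)%N -> \sum_(0 <= t < k) u t <= \sum_(0 <= t < T) u t.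
  by move=> kT; rewrite (big_cat_nat (leq0n k) kT)/= lerDl sumr_ge0.
apply: (@nneg_series_cvg _ (\sum_(0 <= t < T) u t + C)) => // k.
have [kT|/ltnW Tk] := leqP k T.
  by rewrite (le_trans (nd _ kT))// lerDl (le_trans _ (vC 0%N))// big_geq.
rewrite (big_cat_nat (leq0n T) Tk)/= lerD2l (le_trans _ (vC k))//.
rewrite [leRHS](big_cat_nat (leq0n T) Tk)/= ler_wpDl ?sumr_ge0//.
by rewrite big_nat_cond [leRHS]big_nat_cond ler_sum// => t /andP[/andP[Tt _] _]; exact: uv.
Qed.

Lemma near_series_block (V : normedModType R) (u : nat -> V) (e : R) : 0 < e ->
  cvgn (series u) ->
  exists T, forall i j, (T <= i)%N -> (i <= j)%N -> `|\sum_(i <= t < j) u t| < e.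
Proof.
move=> e0 /cvg_cauchy/cauchy_seriesP/(_ e e0).
case=> -[A B] /= [[a _ Aa] [b _ Bb]] AB.
exists (maxn a b) => i j; rewrite geq_max => /andP[ai bi] ij.
apply: (AB (i, j)); split; first exact: Aa.
by apply: Bb; rewrite /= (leq_trans bi).
Qed.

(** A deterministic Robbins-Siegmund argument in which [w] may change sign. Telescoping expresses
    [u] through the two partial sums; the lower bound on [u] then bounds the monotone partial sums
    of [p]. *)
Lemma descent_cvg u p w (L : R) : (forall t, 0 <= p t) -> (forall t, L <= u t) ->
  (forall t, u t.+1 = u t - p t + w t) -> cvgn (series w) ->
  cvgn (series p) /\ cvgn u.
Proof.
move=> p0 uL us cw.
have uE k : u k = u 0%N - series p k + series w k.
  elim: k => [|k IH]; first by rewrite /series/= !big_geq// subr0 addr0.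
  by rewrite us IH /series/= !big_nat_recr//=; ring.
have [C [_ wC]] := cvg_seq_bounded cw.
have cp : cvgn (series p).
  apply: (@nneg_series_cvg _ (u 0%N - L + (C + 1))) => // k.
  (* Boundedness is available for every constant strictly above [C], whence [C + 1]. *)
  have := wC (C + 1) (ltr_pwDr ltr01 (lexx C)) k I.
  have := uL k; rewrite uE /series/= => Lk /ler_normlP[_ wk].
  by lra.
split=> //; rewrite (_ : u = fun k => u 0%N - series p k + series w k).
  apply: is_cvgD => //; apply: is_cvgB => //; exact: is_cvg_cst.
exact/funext.
Qed.

(* An excursion of [y] above [d] that starts below [d] climbs at most [d]
   higher, so once [y] is below [d] at a late time it stays below [2 d]. *)
Lemma crossing_cvg0 y a : (forall t, 0 <= y t) -> (forall t, 0 <= a t) ->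
  cvgn (series (fun t => a t * y t ^+ 2)) -> ~ cvgn (series a) ->
  (forall e, 0 < e -> exists T, forall i j, (T <= i)%N -> (i < j)%N ->
     y i <= e -> (forall t, (i < t < j)%N -> e <= y t) -> y j <= y i + e) ->
  y t @[t --> \oo] --> 0.
Proof.
move=> y0 a0 cay dva cross; apply/cvgrPdist_le => e e0.
pose d := e / 2; have d0 : 0 < d by rewrite divr_gt0.
have [T crossT] := cross d d0.
(* If [y] stayed above [d] from [T] on, then [a t <= d^-2 a t (y t)^2] would make the series of [a]
   converge. *)
have [s Ts ys] : exists2 s, (T <= s)%N & y s < d.
  apply: contrapT => h; apply: dva.
  apply: (@near_series_le_cvg _ (fun t => d ^- 2 * (a t * y t ^+ 2)) T) => //.
  - by move=> t; rewrite !mulr_ge0// ?sqr_ge0// invr_ge0 sqr_ge0.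
  - move=> t Tt; rewrite mulrCA ler_peMr// mulrC ler_pdivlMr ?exprn_gt0// mul1r.
    by rewrite lerXn2r ?nnegrE// ?(ltW d0)// leNgt; apply/negP => ?; apply: h; exists t.
  - exact: (@is_cvg_seriesZ _ _ (d ^- 2) cay).
(* The index [i] is the last one up to [j] at which [y] is below [d], so [j] lies on the excursion
   starting at [i]. *)
have ydd j : (s <= j)%N ->
    exists i, [/\ (s <= i <= j)%N, y i < d & forall t, (i < t <= j)%N -> d <= y t].
  elim: j => [|j IH].
    by rewrite leqn0 => /eqP s0; exists s; rewrite s0; split=> [//||[]//]; rewrite -s0.
  rewrite leq_eqVlt => /predU1P[<-|].
    by exists s; rewrite leqnn; split=> // t /andP[/leq_trans h /h]; rewrite ltnn.
  rewrite ltnS => /IH[i [/andP[si ij] yi yt]].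
  have [yj|yj] := ltP (y j.+1) d.
    exists j.+1; rewrite leqnn andbT (leq_trans si) ?(leq_trans ij)//; split=> // t.
    by move=> /andP[/leq_trans h /h]; rewrite ltnn.
  exists i; rewrite si (leq_trans ij)//; split=> // t /andP[it].
  by rewrite leq_eqVlt => /predU1P[->//|tj]; apply: yt; rewrite it.
near=> j; rewrite sub0r normrN ger0_norm//.
have sj : (s <= j)%N by near: j; exists s.
have [i [/andP[si ij] yi yt]] := ydd j sj.
move: ij; rewrite leq_eqVlt => /predU1P[<-|ij].
  by rewrite (le_trans (ltW yi))// /d ler_pdivrMr// ler_peMr// ?ler1n// ltW.
rewrite (@le_trans _ _ (y i + d))//.
  apply: crossT => //; first exact: leq_trans si.
    exact: ltW.
  by move=> t /andP[it tj]; apply: yt; rewrite it ltnW.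
by rewrite [e]splitr lerD2r ltW.
Unshelve. all: by end_near. Qed.

(** If [t^(1-p) Y t >= d > 0] held from some time on, [b t * Y t] would eventually dominate a
    multiple of [1/(t+1)], against the divergence of the harmonic series. *)
Lemma weighted_series_einf0 (b Y : nat -> R) (k p : R) : 0 < k -> p <= 1 ->
  (forall t, 0 <= Y t) -> (forall t, k * t.+1%:R `^ (- p) <= b t) ->
  cvgn (series (fun t => b t * Y t)) ->
  limn_einf (fun t : nat => (t%:R `^ (1 - p) * Y t)%:E) = 0%E.
Proof.
move=> k0 p1 Y0 kb cbY.
have U0 t : 0 <= t%:R `^ (1 - p) * Y t by rewrite mulr_ge0// powR_ge0.
have b0 t : 0 <= b t by rewrite (le_trans _ (kb t))// mulr_ge0 ?powR_ge0// ltW.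
have often d T : 0 < d -> exists2 t, (T <= t)%N & t%:R `^ (1 - p) * Y t < d.
  move=> d0; apply: contrapT => h; apply: (@dvg_harmonic R).
  apply: (@near_series_le_cvg _ (fun t => (k * d)^-1 * (b t * Y t)) T.+1).
  - by move=> t; exact: harmonic_ge0.
  - by move=> t; rewrite !mulr_ge0// invr_ge0 mulr_ge0// ltW.
  - move=> t Tt; have t0 : 0 < t%:R :> R by rewrite ltr0n (leq_trans _ Tt).
    rewrite ler_pdivlMl ?mulr_gt0// /harmonic/=.
    have dY : d <= t%:R `^ (1 - p) * Y t.
      by rewrite leNgt; apply/negP => ?; apply: h; exists t => //; exact: ltnW.
    apply: (@le_trans _ _ (k * t.+1%:R `^ (- p) * Y t)); last by rewrite ler_wpM2r.
    rewrite -!mulrA ler_pM2l// mulrC ler_pdivrMl//.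
    rewrite mulrA (le_trans dY)// ler_wpM2r//.
    rewrite -[X in _ <= X * _]powRr1// -powRD; last first.
      by apply/implyP => _; rewrite gt_eqF.
    (* Since [p <= 1], the power [1 - p] is nondecreasing, so replacing [t] by [t + 1] goes in the
       right direction. *)
    by rewrite ge0_ler_powR// ?subr_ge0// ?nnegrE// ler_nat.
  - exact: (@is_cvg_seriesZ _ _ ((k * d)^-1) cbY).
have einf0 T : einfs (fun t : nat => (t%:R `^ (1 - p) * Y t)%:E) T = 0%E.
  apply/eqP; rewrite eq_le; apply/andP; split.
    apply/lee_addgt0Pr => d d0; rewrite add0e.
    have [t Tt tY] := often d T d0.
    apply: (@le_trans _ _ (t%:R `^ (1 - p) * Y t)%:E); last by rewrite lee_fin ltW.
    by apply: ereal_inf_lbound; exists t.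
  by apply: le_ereal_inf_tmp => _ [t _ <-]; rewrite lee_fin.
rewrite limn_einf_lim (_ : einfs _ = cst 0%E); last exact/funext.
exact: lim_cst.
Qed.

End real_series.

(** * Euclidean norm and the descent inequality *)

Section euclidean.
Context {R : realType} {n : nat}.
Implicit Types u v : 'rV[R]_n.

Definition dotv u v : R := \sum_(i < n) u ord0 i * v ord0 i.

Lemma dotvC u v : dotv u v = dotv v u.
Proof. by apply: eq_bigr => i _; rewrite mulrC. Qed.

Lemma dotvDl u v w : dotv (u + v) w = dotv u w + dotv v w.
Proof. by rewrite -big_split; apply: eq_bigr => i _; rewrite mxE mulrDl. Qed.

Lemma dotvZl a u v : dotv (a *: u) v = a * dotv u v.
Proof. by rewrite mulr_sumr; apply: eq_bigr => i _; rewrite mxE mulrA. Qed.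

Lemma dotvDr u v w : dotv w (u + v) = dotv w u + dotv w v.
Proof. by rewrite dotvC dotvDl !(dotvC w). Qed.

Lemma dotvZr a u v : dotv u (a *: v) = a * dotv u v.
Proof. by rewrite dotvC dotvZl dotvC. Qed.

Lemma dotvNr u v : dotv u (- v) = - dotv u v.
Proof. by rewrite -scaleN1r dotvZr mulN1r. Qed.

Lemma dotvNl u v : dotv (- u) v = - dotv u v.
Proof. by rewrite dotvC dotvNr dotvC. Qed.

Lemma enorm_ge0 u : 0 <= enorm u.
Proof. exact: sqrtr_ge0. Qed.

Lemma sqr_enorm u : enorm u ^+ 2 = dotv u u.
Proof.
rewrite sqr_sqrtr; last by apply: sumr_ge0 => i _; exact: sqr_ge0.
by apply: eq_bigr => i _; rewrite expr2.
Qed.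

Lemma enormZ a u : enorm (a *: u) = `|a| * enorm u.
Proof.
apply/eqP; rewrite -(@eqrXn2 _ 2)// ?mulr_ge0 ?enorm_ge0//.
by rewrite exprMn !sqr_enorm dotvZl dotvZr mulrA real_normK ?num_real// expr2.
Qed.

Lemma enormN u : enorm (- u) = enorm u.
Proof. by rewrite -scaleN1r enormZ normrN1 mul1r. Qed.

Lemma enorm0 : enorm (0 : 'rV[R]_n) = 0.
Proof. by rewrite -(scale0r 0) enormZ normr0 mul0r. Qed.

Lemma coord_le_enorm u i : `|u ord0 i| <= enorm u.
Proof.
rewrite -(@ler_pXn2r _ 2)// ?nnegrE ?enorm_ge0//.
rewrite real_normK ?num_real// sqr_enorm /dotv (bigD1 i)//= -expr2 lerDl.
by apply: sumr_ge0 => j _; rewrite -expr2 sqr_ge0.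
Qed.

(** Cauchy-Schwarz: with [a], [b] the norms and [s] the inner product, the squared norm of
    [b u - a v] is [2 a b (a b - s)]. Vanishing norms are set aside so that [a b] can be divided
    out. *)
Lemma dotv_le u v : dotv u v <= enorm u * enorm v.
Proof.
have [u0|u0] := eqVneq (enorm u) 0.
  rewrite /dotv big1 ?u0 ?mul0r// => i _.
  by have := coord_le_enorm u i; rewrite u0 normr_le0 => /eqP ->; rewrite mul0r.
have [v0|v0] := eqVneq (enorm v) 0.
  rewrite /dotv big1 ?v0 ?mulr0// => i _.
  by have := coord_le_enorm v i; rewrite v0 normr_le0 => /eqP ->; rewrite mulr0.
have uv0 : 0 < enorm u * enorm v by rewrite mulr_gt0// lt0r ?u0 ?v0 enorm_ge0.
have := sqr_ge0 (enorm (enorm v *: u - enorm u *: v)).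
rewrite sqr_enorm -scaleNr !(dotvDl, dotvDr, dotvZl, dotvZr) -!sqr_enorm (dotvC v u).
set a := enorm u; set b := enorm v; set s := dotv u v => h.
have : 0 <= (a * b) * (a * b - s) by lra.
by rewrite pmulr_rge0// subr_ge0.
Qed.

Lemma abs_dotv_le u v : `|dotv u v| <= enorm u * enorm v.
Proof.
rewrite ler_norml dotv_le andbT lerNl -dotvNr.
by rewrite (le_trans (dotv_le _ _))// enormN.
Qed.

Lemma enormD_le u v : enorm (u + v) <= enorm u + enorm v.
Proof.
rewrite -(@ler_pXn2r _ 2)// ?nnegrE ?addr_ge0 ?enorm_ge0//.
rewrite sqr_enorm !(dotvDl, dotvDr) -!sqr_enorm (dotvC v u) sqrrD.
have := dotv_le u v; lra.
Qed.

Lemma enorm_sum_le (I : Type) (r : seq I) (Q : pred I) (F : I -> 'rV[R]_n) :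
  enorm (\sum_(i <- r | Q i) F i) <= \sum_(i <- r | Q i) enorm (F i).
Proof.
elim/big_ind2 : _ => [|a b c d ab cd|//]; first by rewrite enorm0.
by rewrite (le_trans (enormD_le _ _))// lerD.
Qed.

Lemma enorm_le_sum_coord u : enorm u <= \sum_(i < n) `|u ord0 i|.
Proof.
rewrite {1}(row_sum_delta u); apply: (le_trans (enorm_sum_le _ _ _ _)).
apply: ler_sum => i _; rewrite enormZ ler_piMr//.
rewrite /enorm (bigD1 i)//= big1 ?mxE ?eqxx ?expr1n ?addr0 ?sqrtr1//.
by move=> j /negbTE ji; rewrite mxE eqxx ji expr0n.
Qed.

Lemma ler_enormB u v : `|enorm u - enorm v| <= enorm (u - v).
Proof.
rewrite ler_norml; apply/andP; split.
  rewrite lerNl opprB lerBlDr -(enormN (u - v)) opprB.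
  by rewrite (le_trans _ (enormD_le _ _))// subrK.
by rewrite lerBlDr (le_trans _ (enormD_le _ _))// subrK.
Qed.

(** The limit on the right refers to the maximum norm, which the Euclidean norm dominates. *)
Lemma cvg_enorm0 (w : nat -> 'rV[R]_n) : enorm (w t) @[t --> \oo] --> 0 ->
  w t @[t --> \oo] --> (0 : 'rV[R]_n).
Proof.
move=> w0; apply/cvgrPdist_lt => e e0.
have /cvgrPdist_lt/(_ e e0) := w0; apply: filterS => t.
rewrite !sub0r !normrN ger0_norm ?enorm_ge0// => we.
rewrite -[ltLHS]/(mx_norm (w t)) mx_normrE.
apply/bigmax_ltP; split => // -[i j] _ /=; rewrite ord1.
exact: le_lt_trans (coord_le_enorm _ _) we.
Qed.

Lemma diff_grad (f : 'rV[R]_n -> R) x v : differentiable f x ->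
  'd f x v = dotv (grad f x) v.
Proof.
move=> df; rewrite {1}(row_sum_delta v) linear_sum /dotv; apply: eq_bigr => i _.
by rewrite linearZ /= mxE deriveE// mulrC.
Qed.

(** The mean value theorem on the segment gives [f (z + h) - f z] as the inner product of [h] with
    the gradient at [z + c h], [0 < c < 1]. The Hoelder condition and Cauchy-Schwarz bound the
    change of gradient; the sharper factor [1 / (1 + alpha)] of the integral form is given up. *)
Lemma holder_descent (f : 'rV[R]_n -> R) (A alpha : R) z h :
  0 <= A -> 0 <= alpha -> (forall x, differentiable f x) ->
  (forall y z, enorm (grad f y - grad f z) <= A * enorm (y - z) `^ alpha) ->
  `|f (z + h) - f z - dotv (grad f z) h| <= A * enorm h `^ (1 + alpha).
Proof.
move=> A0 alpha0 df holder.
pose phi (s : R) := f (z + s *: h).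
have dphi (s : R) : is_derive s 1 phi (dotv (grad f (z + s *: h)) h).
  (* The difference quotients of [phi] at [s] are the directional quotients of [f] at [z + s h], so
     derivability and derivative carry over. *)
  have quotE : (fun t : R => t^-1 *: ((phi \o shift s) (t *: 1) - phi s)) =
      (fun t : R => t^-1 *: ((f \o shift (z + s *: h)) (t *: h) - f (z + s *: h))).
    apply/funext => t; rewrite /phi /= /shift.
    congr (_ *: (f _ - _)).
    by rewrite scalerDl -[t *: 1]/(t * 1) mulr1 addrCA.
  have := diff_derivable (v := h) (df (z + s *: h)).
  rewrite /derivable -quotE => dph; apply: DeriveDef => //.
  by rewrite /derive quotE -diff_grad// -deriveE.
have [|c] := @MVT R phi (fun s => dotv (grad f (z + s *: h)) h) 0 1 ltr01
    (fun s _ => dphi s).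
  by apply: derivable_within_continuous => s _; case: (dphi s).
rewrite in_itv/= => /andP[c0 c1]; rewrite subr0 mulr1.
rewrite /phi scale1r scale0r addr0 => ->.
rewrite -[- dotv _ _]mulN1r -dotvZl scaleN1r -dotvDl.
rewrite (le_trans (abs_dotv_le _ _))//.
have -> : A * enorm h `^ (1 + alpha) = A * enorm h `^ alpha * enorm h.
  have [->|h0] := eqVneq (enorm h) 0.
    by rewrite mulr0 powR0 ?mulr0// gt_eqF// ltr_pwDl.
  by rewrite powRD ?h0 ?implybT// powRr1 ?enorm_ge0// mulrAC mulrA.
apply: (ler_wpM2r (enorm_ge0 _)); apply: (le_trans (holder _ _)).
apply: (ler_wpM2l A0).
rewrite addrAC subrr add0r enormZ ge0_ler_powR// ?nnegrE ?mulr_ge0 ?enorm_ge0//.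
by rewrite ler_piMl ?enorm_ge0// ger0_norm ltW.
Qed.

End euclidean.

(** * Pathwise analysis of the momentum recursion *)

Lemma cvg_series_powR_cvg0 {R : realType} (u : nat -> R) (q : R) : 0 < q ->
  (forall t, 0 <= u t) -> cvgn (series (fun t => u t `^ q)) ->
  u t @[t --> \oo] --> 0.
Proof.
move=> q0 u0 /cvg_series_cvg_0 uq0; apply/cvgrPdist_lt => e e0.
have /cvgrPdist_lt/(_ (e `^ q)) := uq0; rewrite powR_gt0// => /(_ erefl).
apply: filterS => t; rewrite !sub0r !normrN !ger0_norm ?powR_ge0//.
apply: contraTT; rewrite -!leNgt => eu.
by rewrite ge0_ler_powR// ?nnegrE// ltW.
Qed.

Lemma is_cvg_bigsum {R : realType} (I : Type) (r : seq I) (F : I -> nat -> R) :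
  (forall i, cvgn (F i)) -> cvgn (fun k => \sum_(i <- r) F i k).
Proof.
move=> cF; elim: r => [|i r IH].
  rewrite (_ : (fun k => _) = cst 0); first exact: is_cvg_cst.
  by apply/funext => k; rewrite big_nil.
rewrite (_ : (fun k => _) = F i + (fun k => \sum_(i <- r) F i k)).
  exact: is_cvgD.
by apply/funext => k; rewrite big_cons.
Qed.

Section adam_path.
Context {R : realType} {n : nat}.
Variables (f : 'rV[R]_n -> R) (A alpha beta L G : R).
Variables (x m gg : nat -> 'rV[R]_n) (a : nat -> R).
Hypothesis df : forall y, differentiable f y.
Hypothesis A0 : 0 < A.
Hypothesis holder :
  forall y z, enorm (grad f y - grad f z) <= A * enorm (y - z) `^ alpha.
Hypothesis alpha0 : 0 < alpha.
Hypothesis beta01 : 0 <= beta < 1.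
Hypothesis fL : forall y, L <= f y.
Hypothesis m0 : m 0%N = 0.
Hypothesis mS : forall t, m t.+1 = beta *: m t - ((1 - beta) * a t) *: gg t.
Hypothesis xS : forall t, x t.+1 = x t + m t.+1.
Hypothesis a0 : forall t, 0 <= a t.
Hypothesis ca : cvgn (series (fun t => a t `^ (1 + alpha))).
Hypothesis gradG : forall t, enorm (grad f (x t)) <= G.
Hypothesis ggG : forall t, enorm (gg t) <= G.
(** The two convergences that probability has to supply on the fixed trajectory: [noise] controls
    the displacement of the iterates, [grad_noise] the decrease of the cost. *)
Hypothesis noise : forall i,
  cvgn (series (fun t => a t * (gg t ord0 i - grad f (x t) ord0 i))).
Hypothesis grad_noise : forall i,
  cvgn (series (fun t => a t * grad f (x t) ord0 i *
    (gg t ord0 i - grad f (x t) ord0 i))).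

Let q := 1 + alpha.
Let c := beta / (1 - beta).
Let z t := x t + c *: m t.

Let q1 : 1 <= q. Proof. by rewrite lerDl ltW. Qed.
Let q0 : 0 < q. Proof. exact: lt_le_trans q1. Qed.
Let G0 : 0 <= G. Proof. exact: le_trans (enorm_ge0 _) (ggG 0%N). Qed.
Let beta1 : 0 < 1 - beta. Proof. by rewrite subr_gt0; case/andP: beta01. Qed.
Let c0 : 0 <= c. Proof. by rewrite divr_ge0 ?(ltW beta1)//; case/andP: beta01. Qed.

(** Because [1 + c = 1 / (1 - beta)], the term [(1 + c) m_(t+1)] equals [c m_t - a_t g_t], and
    [c m_t] is already part of [z_t]. *)
Lemma lookahead_step t : z t.+1 = z t - a t *: gg t.
Proof.
have cE : 1 + c = (1 - beta)^-1.
  by rewrite /c -{1}(divff (lt0r_neq0 beta1)) -mulrDl subrK mul1r.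
rewrite /z xS -addrA -[X in x t + (X + _)]scale1r -scalerDl cE mS.
rewrite scalerBr !scalerA mulrA mulVf ?lt0r_neq0// mul1r addrA.
by rewrite [_^-1 * beta]mulrC.
Qed.

(** The recursion bounds the norm of [m_(t+1)] by the convex combination of that of [m_t] and
    [G a_t] with weights [beta] and [1 - beta]. After convexity of the power [q], the bound [G^q C]
    on partial sums reproduces itself. *)
Lemma cvg_series_momentum : cvgn (series (fun t => enorm (m t) `^ q)).
Proof.
have aq0 t : 0 <= a t `^ q by exact: powR_ge0.
have [C aC] := cvg_nneg_series_ub _ aq0 ca.
have Gq0 : 0 <= G `^ q by exact: powR_ge0.
have C0 : 0 <= C by have := aC 0%N; rewrite big_geq.
have step t : enorm (m t.+1) `^ q <=
    beta * enorm (m t) `^ q + (1 - beta) * (G `^ q * a t `^ q).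
  have [b0 b1] := andP beta01.
  rewrite -powRM// (le_trans _ (powR_convex2 _ _ _ _ q1 _ _ _))//; last 3 first.
  - by rewrite b0 ltW.
  - exact: enorm_ge0.
  - exact: mulr_ge0.
  rewrite ge0_ler_powR ?nnegrE ?enorm_ge0// ?(ltW q0)//.
    by rewrite addr_ge0// mulr_ge0 ?enorm_ge0// ?mulr_ge0// ltW.
  rewrite mS (le_trans (enormD_le _ _))// enormN !enormZ ger0_norm// lerD2l.
  rewrite ger0_norm ?mulr_ge0// ?(ltW beta1)// -mulrA ler_pM2l// [G * _]mulrC.
  by rewrite ler_wpM2l.
apply: (@nneg_series_cvg _ _ (G `^ q * C)) => [t|k]; first exact: powR_ge0.
elim: k => [|k IH]; first by rewrite big_geq// mulr_ge0.
(* The term at time 0 vanishes: [m 0 = 0], and [0 ^ q = 0] because [q] is nonzero. *)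
rewrite big_nat_recl// m0 enorm0 powR0 ?gt_eqF// add0r.
rewrite (le_trans (ler_sum _ (fun t _ => step t)))// big_split/= -!mulr_sumr.
have -> : G `^ q * C = beta * (G `^ q * C) + (1 - beta) * (G `^ q * C) by ring.
rewrite lerD//; first by rewrite ler_wpM2l//; case/andP: beta01.
by rewrite ler_pM2l// ler_wpM2l.
Qed.

Lemma momentum_cvg0 : enorm (m t) @[t --> \oo] --> 0.
Proof.
apply: (cvg_series_powR_cvg0 _ _ q0) cvg_series_momentum => t; exact: enorm_ge0.
Qed.

Let p t := a t * enorm (grad f (x t)) ^+ 2.
Let noise_inner t := a t * dotv (grad f (x t)) (gg t - grad f (x t)).
(** Defined so that the recursion required by [descent_cvg], with [w = err - noise_inner], is an
    identity; the content lies in [err_le]. *)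
Let err t := f (z t.+1) - f (z t) + p t + noise_inner t.

Let cvg_noise_inner : cvgn (series noise_inner).
Proof.
have -> : series noise_inner = (fun k => \sum_(i < n) series (fun t =>
    a t * grad f (x t) ord0 i * (gg t ord0 i - grad f (x t) ord0 i)) k).
  apply/funext => k; rewrite /series/= exchange_big/=; apply: eq_bigr => t _.
  by rewrite /noise_inner /dotv mulr_sumr; apply: eq_bigr => i _; rewrite !mxE mulrA.
by apply: is_cvg_bigsum => i; exact: grad_noise.
Qed.

Let err_le t : `|err t| <= (A * G `^ q + A * c `^ alpha * G) * a t `^ q +
  A * c `^ alpha * G * enorm (m t) `^ q.
Proof.
have := holder_descent f A alpha (z t) (- (a t *: gg t)) (ltW A0) (ltW alpha0) df holder.
rewrite -lookahead_step enormN dotvNr dotvZr opprK => h1.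
have h1' : A * enorm (a t *: gg t) `^ q <= A * G `^ q * a t `^ q.
  rewrite -mulrA ler_pM2l// -powRM// enormZ ger0_norm//.
  rewrite ge0_ler_powR ?nnegrE ?mulr_ge0 ?enorm_ge0// ?(ltW q0)// mulrC.
  by rewrite ler_wpM2r.
have h2 : a t * `|dotv (grad f (z t) - grad f (x t)) (gg t)| <=
    A * c `^ alpha * G * (a t `^ q + enorm (m t) `^ q).
  apply: (@le_trans _ _ (a t * (A * (c * enorm (m t)) `^ alpha * G))).
    rewrite ler_wpM2l// (le_trans (abs_dotv_le _ _))//.
    rewrite ler_pM ?enorm_ge0// (le_trans (holder _ _))//.
    by rewrite /z addrAC subrr add0r enormZ ger0_norm.
  rewrite powRM ?enorm_ge0//.
  have -> : a t * (A * (c `^ alpha * enorm (m t) `^ alpha) * G) =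
    A * c `^ alpha * G * (a t * enorm (m t) `^ alpha) by ring.
  apply: (ler_wpM2l (mulr_ge0 (mulr_ge0 (ltW A0) (powR_ge0 _ _)) G0)).
  by apply: mul_powR_le => //; exact: enorm_ge0.
(* Two sources of error: the Hoelder remainder of the step from [z_t], and the gradient being taken
   at [z_t] instead of [x_t], where [z_t - x_t = c m_t]. *)
have -> : err t = (f (z t.+1) - f (z t) + a t * dotv (grad f (z t)) (gg t)) -
    a t * dotv (grad f (z t) - grad f (x t)) (gg t).
  rewrite /err /p /noise_inner sqr_enorm dotvDr dotvNr dotvDl dotvNl.
  ring.
rewrite (le_trans (ler_normB _ _))// normrM (ger0_norm (a0 t)).
rewrite (le_trans (lerD (le_trans h1 h1') h2))// le_eqVlt; apply/orP; left; apply/eqP.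
ring.
Qed.

Let cvg_err : cvgn (series err).
Proof.
apply: normed_cvg.
apply: (series_le_cvg _ _ err_le) => [t|t|]; first exact: normr_ge0.
  by rewrite addr_ge0// !mulr_ge0 ?addr_ge0 ?mulr_ge0 ?powR_ge0// ltW.
apply: is_cvg_seriesD.
  exact: (@is_cvg_seriesZ _ _ (A * G `^ q + A * c `^ alpha * G) ca).
exact: (@is_cvg_seriesZ _ _ (A * c `^ alpha * G) cvg_series_momentum).
Qed.

Let descent : cvgn (series p) /\ cvgn (f \o z).
Proof.
apply: (@descent_cvg _ (f \o z) p (fun t => err t - noise_inner t) L) => [t|t|t|].
- by rewrite mulr_ge0// sqr_ge0.
- exact: fL.
- by rewrite /err /=; ring.
- exact: (is_cvg_seriesB cvg_err cvg_noise_inner).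
Qed.

Lemma cvg_series_sqr_grad :
  cvgn (series (fun t => a t * enorm (grad f (x t)) ^+ 2)).
Proof. exact: descent.1. Qed.

(** Convergence is known for [f (z_t)]. As the gradients at [x_t] are bounded and
    [z_t - x_t = c m_t] tends to 0, [f (x_t)] has the same limit. *)
Lemma cvg_cost : cvgn (fun t => f (x t)).
Proof.
have fzx : f (z t) - f (x t) @[t --> \oo] --> 0.
  pose bd t := G * c * enorm (m t) + A * c `^ q * enorm (m t) `^ q.
  have bd0 : bd t @[t --> \oo] --> 0.
    rewrite -[X in _ --> X](addr0 0); apply: cvgD.
      by rewrite -[X in _ --> X](mulr0 (G * c)); apply: cvgMr; exact: momentum_cvg0.
    rewrite -[X in _ --> X](mulr0 (A * c `^ q)); apply: cvgMr.
    exact: (cvg_series_cvg_0 cvg_series_momentum).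
  apply/cvgr0Pnorm_le => e e0; have /cvgr0Pnorm_le/(_ e e0) := bd0.
  apply: filterS => t; apply: le_trans.
  rewrite [leRHS]ger0_norm; last first.
    by rewrite /bd addr_ge0// mulr_ge0 ?enorm_ge0 ?powR_ge0// mulr_ge0 ?powR_ge0// ltW.
  have h := holder_descent f A alpha (x t) (c *: m t) (ltW A0) (ltW alpha0) df holder.
  rewrite -[f (z t) - f (x t)](subrK (dotv (grad f (x t)) (c *: m t))).
  apply: (le_trans (ler_normD _ _)); rewrite addrC; apply: lerD.
    apply: (le_trans (abs_dotv_le _ _)); rewrite enormZ (ger0_norm c0) -mulrA.
    by rewrite ler_wpM2r// mulr_ge0// enorm_ge0.
  apply: (le_trans h); rewrite enormZ (ger0_norm c0) -mulrA (powRM _ c0 (enorm_ge0 _)).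
  exact: lexx.
rewrite (_ : (fun t => _) = (fun t => f (z t) - (f (z t) - f (x t)))).
  apply: is_cvgB; first exact: descent.2.
  by apply/cvg_ex; exists 0.
by apply/funext => t; rewrite opprB addrC subrK.
Qed.

Let near_noise e : 0 < e -> exists T, forall i j, (T <= i)%N -> (i <= j)%N ->
  enorm (\sum_(i <= t < j) a t *: (gg t - grad f (x t))) <= e.
Proof.
(* One share of [e] per coordinate; [n + 1] keeps the division meaningful in dimension 0. *)
move=> e0; pose e' := e / n.+1%:R.
have e'0 : 0 < e' by rewrite divr_gt0.
have [T hT] := choice (fun k => near_series_block _ _ _ e'0 (noise k)).
exists (\max_k T k)%N => i j Ti ij.
rewrite (le_trans (enorm_le_sum_coord _))//.
apply: (@le_trans _ _ (\sum_(k < n) e')).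
  apply: ler_sum => k _; rewrite summxE.
  have coordE t : (a t *: (gg t - grad f (x t))) ord0 k =
      a t * (gg t ord0 k - grad f (x t) ord0 k).
    by rewrite mxE; congr (_ * _); rewrite mxE; congr (_ + _); rewrite mxE.
  under eq_bigr do rewrite coordE.
  by rewrite ltW// hT// (leq_trans _ Ti)// leq_bigmax.
rewrite sumr_const card_ord -mulr_natr /e' mulrAC ler_pdivrMr//.
by rewrite ler_pM2l// ler_nat.
Qed.

Lemma grad_cvg0 : ~ cvgn (series a) -> enorm (grad f (x t)) @[t --> \oo] --> 0.
Proof.
move=> dva; apply: (@crossing_cvg0 _ _ a) => //.
- by move=> t; exact: enorm_ge0.
- exact: cvg_series_sqr_grad.
move=> e e0.
(* The displacement for which the Hoelder condition allows a gradient change of exactly [e]. *)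
pose rho := (e / A) `^ alpha^-1.
have rho0 : 0 < rho by rewrite powR_gt0// divr_gt0.
have rhoE : A * rho `^ alpha = e.
  by rewrite -powRrM mulVf ?gt_eqF// powRr1 ?divr_ge0 ?ltW// mulrC divfK// gt_eqF.
(* Five contributions to [x_j - x_i]: [c m_i], [c m_j], the noise, the first gradient step, and the
   remaining gradient steps. *)
pose r := rho / 5.
have r0 : 0 < r by rewrite divr_gt0.
have a_cvg0 : a t @[t --> \oo] --> 0 by exact: cvg_series_powR_cvg0 q0 a0 ca.
(* Dividing by [k + 1] also covers [k = 0], which occurs for [c] when [beta = 0]. *)
have small (u : nat -> R) k : 0 <= k -> (forall t, 0 <= u t) ->
    u t @[t --> \oo] --> 0 -> exists T, forall t, (T <= t)%N -> k * u t <= r.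
  move=> k0 u0 /cvgr0Pnorm_le/(_ (r / (k + 1))).
  have k1 : 0 < k + 1 by rewrite ltr_wpDl.
  rewrite divr_gt0// => /(_ erefl)[T _ hT]; exists T => t /hT /=.
  rewrite ger0_norm// ler_pdivlMr// mulrDr mulr1 mulrC; apply: le_trans.
  by rewrite lerDl.
have [T1 hT1] := small a e (ltW e0) a0 a_cvg0.
have [T2 hT2] := small _ c c0 (fun t => enorm_ge0 (m t)) momentum_cvg0.
have [T3 hT3] := near_noise r r0.
have [T4 hT4] := near_series_block _ _ _ (mulr_gt0 e0 r0) cvg_series_sqr_grad.
exists (maxn (maxn T1 T2) (maxn T3 T4)) => i j.
rewrite !geq_max => /andP[/andP[iT1 iT2] /andP[iT3 iT4]] ij yi yt.
suff : `|enorm (grad f (x j)) - enorm (grad f (x i))| <= e.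
  by move/ler_normlP => [_]; rewrite lerBlDl.
rewrite (le_trans (ler_enormB _ _))// (le_trans (holder _ _))// -rhoE ler_pM2l//.
rewrite ge0_ler_powR ?nnegrE ?enorm_ge0 ?(ltW rho0) ?(ltW alpha0)//.
have zE k l : (k <= l)%N -> z l - z k = - (\sum_(k <= t < l) a t *: grad f (x t)) -
    \sum_(k <= t < l) a t *: (gg t - grad f (x t)).
  move=> kl; rewrite -(telescope_sumr _ kl) -!sumrN -big_split/=.
  apply: eq_bigr => t _; rewrite lookahead_step addrAC subrr add0r.
  by rewrite scalerBr opprB addKr.
have -> : x j - x i = (z j - z i) - c *: m j + c *: m i.
  by rewrite /z; apply/rowP => k; rewrite !mxE; ring.
have cm t : (T2 <= t)%N -> enorm (c *: m t) <= r.
  by move=> Tt; rewrite enormZ ger0_norm// hT2.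
(* At time [i] the gradient norm is at most [e], and the step is small because [a_i] is. Strictly
   between [i] and [j] it is at least [e], so [e] times the length of a step is at most [p t], whose
   late blocks sum to less than [e r]. *)
have drift : enorm (\sum_(i <= t < j) a t *: grad f (x t)) <= r + r.
  rewrite big_ltn// (le_trans (enormD_le _ _))// lerD//.
    rewrite enormZ ger0_norm// (le_trans _ (hT1 i iT1))// mulrC.
    by rewrite ler_wpM2r.
  rewrite (le_trans (enorm_sum_le _ _ _ _))//.
  have : e * \sum_(i.+1 <= t < j) enorm (a t *: grad f (x t)) <= e * r.
    rewrite mulr_sumr (@le_trans _ _ (\sum_(i.+1 <= t < j) p t))//.
      rewrite big_nat_cond [leRHS]big_nat_cond.
      apply: ler_sum => t /andP[/andP[it tj] _].
      rewrite enormZ ger0_norm// /p mulrCA ler_wpM2l// expr2 ler_wpM2r ?enorm_ge0//.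
      by apply: yt; rewrite it.
    rewrite (le_trans (ler_norm _))// ltW// hT4//; exact: leqW.
  by rewrite ler_pM2l.
rewrite (le_trans (enormD_le _ _))//.
have -> : rho = (r + r + r + r) + r by rewrite /r; field.
rewrite lerD//; last exact: cm.
rewrite (le_trans (enormD_le _ _))// enormN lerD//; last first.
  by apply: cm; rewrite (leq_trans iT2)// ltnW.
rewrite zE; last exact: ltnW.
rewrite (le_trans (enormD_le _ _))// !enormN lerD// hT3//; exact: ltnW.
Qed.

End adam_path.

(** * Independence and the sigma-algebra of the past *)

(** Freezing argument: the product rule identifies the law of [(Y, X)] with the product of the laws,
    and Fubini integrates [X] out first with [y] fixed. *)
Lemma integral_independent0 {d d1 d2} {T : measurableType d} {T1 : measurableType d1}
    {T2 : measurableType d2} {R : realType} (P : probability T R)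
    (Y : {RV P >-> T1}) (X : {RV P >-> T2}) (h : T1 * T2 -> \bar R) :
    (forall A B, measurable A -> measurable B ->
      P (Y @^-1` A `&` X @^-1` B) = (P (Y @^-1` A) * P (X @^-1` B))%E) ->
    measurable_fun setT h ->
    P.-integrable setT (fun w => h (Y w, X w)) ->
    (forall y, P.-integrable setT (fun w => h (y, X w))) ->
    (forall y, (\int[P]_w h (y, X w) = 0)%E) ->
  (\int[P]_w h (Y w, X w) = 0)%E.
Proof.
move=> indep mh ih ihy h0.
have mYX : measurable_fun setT (fun w => (Y w, X w)).
  exact: measurable_fun_pair.
pose YX := mfun_Sub (mem_set mYX) : {mfun T >-> (T1 * T2)%type}.
have prodE A : measurable A ->
    (distribution P Y \x distribution P X)%E A = distribution P YX A.
  apply: product_measure_unique => {}A B mA mB.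
  by rewrite -indep.
transitivity (\int[distribution P YX]_z h z)%E.
  by rewrite integral_distribution.
have iYX : (distribution P YX).-integrable setT h.
  exact: integrable_pushforward.
have iprod : (distribution P Y \x distribution P X)%E.-integrable setT h.
  apply/integrableP; split => //.
  rewrite (eq_measure_integral (distribution P YX)).
    by case/integrableP: iYX.
  by move=> A mA _; exact: prodE.
rewrite (eq_measure_integral (distribution P Y \x distribution P X)%E); last first.
  by move=> A mA _; rewrite /= prodE.
rewrite -integral12_prod_meas1//.
apply: integral0_eq => y _ /=; rewrite /fubini_F.
rewrite (@integral_distribution _ _ _ _ _ P X (fun x => h (y, x)))//.
- exact: h0.
- by apply: measurableT_comp => //; exact: measurable_pair1.
- exact: ihy.
Qed.

Section past_sigma_algebra.
Context {dO dE} {Omega : measurableType dO} {E : measurableType dE} {R : realType}.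
Variables (P : probability Omega R) (xi : nat -> {RV P >-> E}).

(* The cylinders form a pi-system, so independence of [xi t] from the cylinders
   extends to the sigma-algebra of [past t]. *)
Definition past_cylinder t : set (set Omega) :=
  [set B | exists2 A : nat -> set E, forall i, measurable (A i) &
     B = \bigcap_(i in [set k | (k < t)%N]) (xi i @^-1` A i)].

(** A type with carrier [Omega], so that measurability with respect to the first [t] queries is
    expressed by the type of the domain. *)
Definition past t := g_sigma_algebraType (past_cylinder t).

Lemma past_cylinderT t : past_cylinder t setT.
Proof.
exists (fun=> setT) => //.
by rewrite bigcapT// => i _; rewrite preimage_setT.
Qed.

Lemma past_cylinderI t : setI_closed (past_cylinder t).
Proof.
move=> _ _ [A mA ->] [B mB ->].
exists (fun i => A i `&` B i); first by move=> i; exact: measurableI.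
by rewrite -bigcapI; apply: eq_bigcapr => i _; rewrite preimage_setI.
Qed.

Lemma past_cylinder_measurable t : past_cylinder t `<=` measurable.
Proof.
move=> _ [A mA ->]; apply: bigcap_measurableType => k _.
by rewrite -[X in measurable X]setTI; exact: measurable_funPT.
Qed.

Lemma measurable_past t : @measurable _ (past t) `<=` @measurable _ Omega.
Proof.
apply: smallest_sub => //; last exact: past_cylinder_measurable.
by split => // [A mA|F mF]; [exact: measurableD|exact: bigcupT_measurable].
Qed.

Lemma measurable_fun_past {d} {T : measurableType d} t (h : Omega -> T) :
  measurable_fun [set: past t] h -> measurable_fun [set: Omega] h.
Proof. by move=> mh _ A mA; apply: measurable_past; exact: mh. Qed.

Lemma past_cylinder_le s t : (s <= t)%N -> past_cylinder s `<=` past_cylinder t.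
Proof.
move=> st _ [A mA ->].
exists (fun i => if (i < s)%N then A i else setT).
  by move=> i; case: ifP.
apply/seteqP; split => [w wA i/= it|w wA i/= si].
  by case: ifPn => // si; exact: wA.
by have := wA i; rewrite /= si (leq_trans si st); exact.
Qed.

Lemma past_le {d} {T : measurableType d} s t (h : Omega -> T) : (s <= t)%N ->
  measurable_fun [set: past s] h -> measurable_fun [set: past t] h.
Proof.
move=> st mh _ A mA.
have := mh measurableT A mA; apply: (sub_smallest2r _ (past_cylinder_le _ _ st)).
exact: smallest_sigma_algebra.
Qed.

Lemma measurable_xi_past t : measurable_fun [set: past t.+1] (xi t).
Proof.
move=> _ A mA; rewrite setTI; apply: sub_sigma_algebra.
exists (fun i => if i == t then A else setT); first by move=> i; case: ifP.
apply/seteqP; split => [w wA i /= it|w wA /=]; first by case: eqP => // ->.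
by have := wA t; rewrite /= eqxx ltnSn; exact.
Qed.

(** As functions of [A], both sides are finite measures: a restriction and a scalar multiple of [P].
    They agree on the cylinders, which form a pi-system containing the whole space. *)
Lemma past_independent t : mutually_independent xi ->
  forall (A : set (past t)) (B : set E), measurable A -> measurable B ->
  P (A `&` xi t @^-1` B) = (P A * P (xi t @^-1` B))%E.
Proof.
move=> indep A B mA mB.
have mxiB : measurable (xi t @^-1` B).
  by rewrite -[X in measurable X]setTI; exact: measurable_funPT.
pose r : {nonneg R} := NngNum (fine_ge0 (measure_ge0 P (xi t @^-1` B))).
have finB : P (xi t @^-1` B) \is a fin_num by exact: fin_num_measure.
rewrite muleC -(fineK finB).
have cov : \bigcup_(k in @setT nat) (@setT Omega) = setT by apply: bigcup_const; exists 0%N.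
have := @g_sigma_algebra_measure_unique _ R Omega (past_cylinder t)
  (past_cylinder_measurable t) (fun=> setT) (fun=> past_cylinderT t)
  cov (mrestr P mxiB) (mscale r P) (past_cylinderI t).
apply => //; last first.
  move=> _; rewrite [ltLHS](_ : _ = P (setT `&` xi t @^-1` B))// setTI.
  by rewrite (le_lt_trans (probability_le1 _ _))// ltry.
move=> _ [C mC ->]; 
(* Inserting [B] at index [t] makes both sides instances of mutual independence, over [J] with [t]
   added and over [J]. *)
pose C' i := if i == t then B else C i.
have mC' i : measurable (C' i) by rewrite /C'; case: ifP.
pose J : {fset nat} := [fset x in iota 0 t]%fset.
have tJ : t \notin J by rewrite !inE mem_iota ltnn andbF.
have JE : \bigcap_(i in [set k | (k < t)%N]) (xi i @^-1` C i) =
          \bigcap_(i in [set` J]) (xi i @^-1` C' i).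
  apply/seteqP; split => w wC i /=.
    rewrite !inE mem_iota add0n /C' => /= it.
    by rewrite (ltn_eqF it); exact: wC.
  move=> it; have := wC i; rewrite /= !inE mem_iota add0n/= /C' (ltn_eqF it).
  exact.
have CtE : xi t @^-1` B = xi t @^-1` C' t by rewrite /C' eqxx.
set S := \bigcap_(i in _) _.
transitivity (P (S `&` xi t @^-1` B)); first by [].
transitivity (P (xi t @^-1` B) * P S)%E; last by rewrite -[in LHS](fineK finB).
rewrite /S JE CtE setIC -(bigcap_fsetU1 (fun i => xi i @^-1` C' i)).
rewrite (indep (t |` J)%fset C' mC') (indep J C' mC').
by rewrite big_fsetU1.
Qed.

End past_sigma_algebra.
Arguments past {dO dE Omega E R P} xi t.
Arguments measurable_fun_past {dO dE Omega E R P} xi {d T} t {h}.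
Arguments past_le {dO dE Omega E R P} xi {d T} {s t h}.

(** * Almost sure convergence of martingale series *)

Lemma sum_nat_shift {V : nmodType} (F : nat -> V) m k :
  \sum_(m <= i < m + k) F i = \sum_(i < k) F (m + i)%N.
Proof.
rewrite -{1}[m]add0n big_addn addKn big_mkord.
by apply: eq_bigr => i _; rewrite addnC.
Qed.

Section ae_bounded.
Context {d} {T : measurableType d} {R : realType} (P : probability T R).
Implicit Types (f : T -> R) (B : R).

Lemma ae_bounded_integral f B : 0 <= B -> measurable_fun setT f -> (forall w, 0 <= f w) ->
  {ae P, forall w, f w <= B} -> (\int[P]_w (f w)%:E <= B%:E)%E.
Proof.
move=> B0 mf f0 fB.
rewrite -[leRHS]mule1 -(probability_setT P) -integral_cst//.
apply: ae_ge0_le_integral => //.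
- by move=> w _; rewrite lee_fin.
- exact/measurable_EFinP.
- by apply: filterS fB => w fB _; rewrite lee_fin.
Qed.

Lemma ae_bounded_integrable f B : measurable_fun setT f ->
  {ae P, forall w, `|f w| <= B} -> P.-integrable setT (EFin \o f).
Proof.
move=> mf fB; apply/integrableP; split; first exact/measurable_EFinP.
apply: (@le_lt_trans _ _ `|B|%:E); last exact: ltry.
apply: (@ae_bounded_integral (fun w => `|f w|)) => //; first exact: measurableT_comp.
by apply: filterS fB => w /le_trans; apply; exact: ler_norm.
Qed.

End ae_bounded.

(* Freezing the partial sums once they reach [lam] replaces the maximum of
   Kolmogorov's inequality by a single time, where Markov's inequality applies. *)
Fixpoint stopped_sum {T : Type} {R : realType} (lam : R) (D : nat -> T -> R)
    (k : nat) (w : T) : R :=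
  if k is j.+1 then
    let s := stopped_sum lam D j w in s + (`|s| < lam)%R%:R * D j w
  else 0.

Section stopped_sum_path.
Context {T : Type} {R : realType}.
Variables (lam : R) (D : nat -> T -> R).

Lemma stopped_sum_le j k w : (j <= k)%N ->
  lam <= `|stopped_sum lam D j w| -> lam <= `|stopped_sum lam D k w|.
Proof.
move=> + lamj; elim: k => [|k IH]; first by rewrite leqn0 => /eqP <-.
rewrite leq_eqVlt => /predU1P[<-//|/IH lamk] /=.
by rewrite ltNge lamk mul0r addr0.
Qed.

(** A stopped sum below [lam] at time [k] was below it at every earlier time, so no increment was
    suppressed. *)
Lemma stopped_sumE k w : `|stopped_sum lam D k w| < lam ->
  stopped_sum lam D k w = \sum_(i < k) D i w.
Proof.
elim: k => [|k IH] lamk; first by rewrite big_ord0.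
have lamk' : `|stopped_sum lam D k w| < lam.
  by rewrite ltNge; apply/negP => /(stopped_sum_le _ _ _ (leqnSn k)); rewrite leNgt lamk.
by rewrite /= lamk' mul1r big_ord_recr/= IH.
Qed.

Lemma stopped_sum_ge k w : lam <= `|\sum_(i < k) D i w| ->
  lam <= `|stopped_sum lam D k w|.
Proof.
by move=> lamk; rewrite leNgt; apply/negP => /[dup] /stopped_sumE ->; rewrite ltNge lamk.
Qed.

Lemma stopped_sum_bound (c : nat -> R) k w : (forall i, `|D i w| <= c i) ->
  `|stopped_sum lam D k w| <= \sum_(i < k) c i.
Proof.
move=> Dc; elim: k => [|k IH] /=; first by rewrite normr0 big_ord0.
rewrite big_ord_recr/= (le_trans (ler_normD _ _))// lerD// normrM.
by rewrite (le_trans _ (Dc k))// ler_piMl// ger0_norm// lern1 leq_b1.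
Qed.

End stopped_sum_path.

Section martingale_series.
Context {dO dE} {Omega : measurableType dO} {E : measurableType dE} {R : realType}.
Variables (P : probability Omega R) (xi : nat -> {RV P >-> E}).

(* Conditional expectations are avoided: [E[D_t | past] = 0] is tested against
   past-measurable multipliers. *)
Definition martingale_difference (D : nat -> Omega -> R) :=
  (forall t, measurable_fun [set: past xi t.+1] (D t)) /\
  (forall t (Z : Omega -> R), measurable_fun [set: past xi t] Z ->
     P.-integrable setT (EFin \o (fun w => Z w * D t w)) ->
     (\int[P]_w (Z w * D t w)%:E = 0)%E).

Section maximal_inequality.
Variables (D : nat -> Omega -> R) (c : nat -> R) (lam : R) (m : nat).
Hypothesis hD : martingale_difference D.
Hypothesis Dc : {ae P, forall w, forall t, `|D t w| <= c t}.

(** Summation starts at [m], so that the inequality applies to tails of the series. *)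
Let S := stopped_sum lam (fun i => D (m + i)%N).

Let ind k w : R := (`|S k w| < lam)%R%:R.

Let mind k : measurable_fun [set: past xi (m + k)] (S k) ->
  measurable_fun [set: past xi (m + k)] (ind k).
Proof.
move=> mS; rewrite /ind.
rewrite (_ : (fun w => _) = (fun w => if `|S k w| < lam then 1 else 0)); last first.
  by apply/funext => w; case: ifP.
apply: measurable_fun_ifT => //.
by apply: measurable_fun_ltr => //; exact: measurableT_comp.
Qed.

Let mS k : measurable_fun [set: past xi (m + k)] (S k).
Proof.
elim: k => [|k IH]; first exact: measurable_cst.
rewrite addnS /S/=; apply: measurable_funD; first exact: past_le _ _ IH.
apply: measurable_funM; last exact: hD.1.
exact: (past_le _ (leqnSn (m + k)) (mind _ IH)).
Qed.

Let Sbound k : {ae P, forall w, `|S k w| <= \sum_(i < k) c (m + i)%N}.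
Proof.
by apply: filterS Dc => w Dcw; apply: (stopped_sum_bound _ _ (fun i => c (m + i)%N)) => i.
Qed.

(** Orthogonality of increments: the cross term of the square is [D] times the past-measurable [Z]
    and integrates to 0, while the squared increment [Q] is at most the square of its bound. *)
Lemma stopped_sum_variance k :
  (\int[P]_w (S k w ^+ 2)%:E <= (\sum_(i < k) c (m + i)%N ^+ 2)%:E)%E.
Proof.
elim: k => [|k IH].
  by rewrite big_ord0 integral0_eq// => w _; rewrite /S/= expr0n.
pose Z w := S k w *+ 2 * ind k w.
pose Q w := ind k w * D (m + k)%N w ^+ 2.
have ind01 w : 0 <= ind k w <= 1 by rewrite /ind ler0n lern1 leq_b1.
have mZ : measurable_fun [set: past xi (m + k)] Z.
  apply: measurable_funM; last exact: (mind _ (mS k)).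
  by rewrite (_ : (fun w => _) = S k \+ S k)//; exact: measurable_funD.
have mD : measurable_fun [set: Omega] (D (m + k)%N).
  exact: measurable_fun_past _ _ (hD.1 _).
have mSk : measurable_fun [set: Omega] (S k) by exact: measurable_fun_past _ _ (mS k).
have mQ : measurable_fun [set: Omega] Q.
  apply: measurable_funM; first exact: measurable_fun_past _ _ (mind _ (mS k)).
  exact: measurable_funX.
have Dc2 : {ae P, forall w, D (m + k)%N w ^+ 2 <= c (m + k)%N ^+ 2}.
  apply: filterS Dc => w /(_ (m + k)%N) Dcw.
  by rewrite -real_normK ?num_real// lerXn2r// nnegrE (le_trans _ Dcw).
have Q0 w : 0 <= Q w by rewrite mulr_ge0// ?sqr_ge0//; case/andP: (ind01 w).
have Qc : {ae P, forall w, Q w <= c (m + k)%N ^+ 2}.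
  apply: filterS Dc2 => w; apply: le_trans.
  by rewrite ler_piMl// ?sqr_ge0//; case/andP: (ind01 w).
have iQ : P.-integrable setT (EFin \o Q).
  apply: (@ae_bounded_integrable _ _ _ _ _ (c (m + k)%N ^+ 2)) => //.
  by apply: filterS Qc => w; rewrite ger0_norm.
pose M := \sum_(i < k) c (m + i)%N.
have iS : P.-integrable setT (EFin \o (fun w => S k w ^+ 2)).
  apply: (@ae_bounded_integrable _ _ _ _ _ (M ^+ 2)).
    exact: measurable_funX.
  apply: filterS (Sbound k) => w SM.
  by rewrite normrX lerXn2r// nnegrE (le_trans _ SM).
have iZD : P.-integrable setT (EFin \o (fun w => Z w * D (m + k)%N w)).
  apply: (@ae_bounded_integrable _ _ _ _ _ (M *+ 2 * 1 * c (m + k)%N)).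
    by apply: measurable_funM => //; exact: measurable_fun_past _ _ mZ.
  apply: filterS2 (Sbound k) Dc => w SM /(_ (m + k)%N) Dcw.
  rewrite !normrM; apply: ler_pM => //; apply: ler_pM => //.
    by rewrite normrMn lerMn2r SM orbT.
  by rewrite ger0_norm; case/andP: (ind01 w).
have -> : (fun w => (S k.+1 w ^+ 2)%:E) =
    (fun w => (S k w ^+ 2)%:E + (Z w * D (m + k)%N w)%:E + (Q w)%:E)%E.
  apply/funext => w; rewrite -!EFinD; congr EFin.
  rewrite /S/= -/(S k w) /Z /Q -/(ind k w) sqrrD; congr (_ + _ + _).
    by rewrite mulrA -!mulrnAl.
  rewrite exprMn; congr (_ * _).
  (* The indicator equals its own square. *)
  by rewrite /ind; case: (_ < _); rewrite ?expr1n// expr0n.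
rewrite integralD//=; last exact: integrableD.
rewrite integralD//= (hD.2 _ _ mZ iZD) adde0 big_ord_recr/= EFinD.
by apply: leeD => //; apply: ae_bounded_integral => //; exact: sqr_ge0.
Qed.

(** Markov's inequality for the square of the stopped sum bounds each [P (B k)]. Freezing makes
    [B k] increase with [k], so the bound passes to the union by continuity from below. *)
Lemma maximal_inequality (V : R) : 0 < lam ->
  (forall k, \sum_(i < k) c (m + i)%N ^+ 2 <= V) ->
  exists B : set Omega, [/\ measurable B, (P B <= (V / lam ^+ 2)%:E)%E &
    [set w | exists k, lam <= `|\sum_(i < k) D (m + i)%N w|] `<=` B].
Proof.
move=> lam0 cV.
pose B k := [set w | lam <= `|S k w|].
have mB k : measurable (B k).
  rewrite -[B k]setTI.
  have mN : measurable_fun [set: Omega] (fun w => `|S k w|).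
    by apply: measurableT_comp => //; exact: measurable_fun_past _ _ (mS k).
  have := mN measurableT _ (measurable_itv `[lam, +oo[%R).
  congr (measurable _); congr (_ `&` _); apply/seteqP.
  by split => w /=; rewrite in_itv/= andbT.
have PB k : (P (B k) <= (V / lam ^+ 2)%:E)%E.
  have mSk : measurable_fun [set: Omega] (S k) by exact: measurable_fun_past _ _ (mS k).
  pose X : {RV P >-> R} := mfun_Sub (mem_set mSk).
  have sqr_homo : {in Num.nneg &, {homo (fun x : R => x ^+ 2) : x y / x <= y}}.
    by move=> x y x0 y0 xy; rewrite lerXn2r.
  have h := @markov _ _ _ P X (fun x => x ^+ 2) lam lam0
    (measurable_funX 2 (@measurable_id _ _ setT)) (fun r _ => sqr_ge0 r) sqr_homo.
  rewrite EFinM lee_pdivlMr ?exprn_gt0// muleC.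
  apply: (le_trans h); apply: (@le_trans _ _ (\sum_(i < k) c (m + i)%N ^+ 2)%:E).
    rewrite (_ : _ \o _ = (fun w => S k w ^+ 2)).
      rewrite unlock; exact: stopped_sum_variance.
    by apply/funext => w /=; rewrite real_normK ?num_real.
  by rewrite lee_fin.
exists (\bigcup_k B k); split.
- exact: bigcupT_measurable.
- have : (P \o B) k @[k --> \oo] --> P (\bigcup_k B k).
    apply: nondecreasing_cvg_mu => //; first exact: bigcupT_measurable.
    by move=> j k jk; apply/subsetPset => w; exact: stopped_sum_le.
  move=> /cvg_lim <-//; apply: lime_le; last by near=> k; exact: PB.
  apply: ereal_nondecreasing_is_cvgn => j k jk /=.
  by apply: le_measure; rewrite ?inE// => w; exact: stopped_sum_le.
- by move=> w [k lamk]; exists k => //; exact: stopped_sum_ge.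
Unshelve. all: by end_near. Qed.

End maximal_inequality.

(** The maximal inequality on late tails shows that, almost surely, for each [j] some tail has all
    its partial sums below [1/(j+1)]; this is the Cauchy criterion. *)
Theorem martingale_series_cvg (D : nat -> Omega -> R) (c : nat -> R) :
  martingale_difference D -> {ae P, forall w, forall t, `|D t w| <= c t} ->
  cvgn (series (fun t => c t ^+ 2)) ->
  {ae P, forall w, cvgn (series (D ^~ w))}.
Proof.
move=> hD Dc cc.
have c0 t : 0 <= c t ^+ 2 by exact: sqr_ge0.
have tail e : 0 < e -> exists m, forall k, \sum_(i < k) c (m + i)%N ^+ 2 <= e.
  move=> e0; have /cauchy_cvgP/cauchy_seriesP/(_ e e0) := cc.
  case=> -[A B] /= [[a _ Aa] [b _ Bb]] AB.
  exists (maxn a b) => k.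
  have : `|\sum_(maxn a b <= i < maxn a b + k) c i ^+ 2| < e.
    apply: (AB (maxn a b, maxn a b + k)%N); split.
      by apply: Aa; rewrite /= leq_maxl.
    by apply: Bb; rewrite /= (leq_trans (leq_maxr a b))// leq_addr.
  by rewrite sum_nat_shift ger0_norm ?sumr_ge0// => /ltW.
pose small j w := exists m, forall k, `|\sum_(i < k) D (m + i)%N w| < j.+1%:R^-1.
have smallP : {ae P, forall w, forall j, small j w}.
  apply: ae_foralln => j.
  have lam0 : 0 < j.+1%:R^-1 :> R by rewrite invr_gt0.
  have bad i : exists B : set Omega, [/\ measurable B, (P B <= (i.+1%:R^-1)%:E)%E &
      ~` (small j) `<=` B].
    (* Variance budget chosen so that division by the squared level [(j+1)^-2] leaves the
       probability [1/(i+1)]. *)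
    have [|m cm] := tail (i.+1%:R^-1 * j.+1%:R^-1 ^+ 2).
      by rewrite mulr_gt0// ?exprn_gt0// invr_gt0.
    have [B [mB PB sB]] := maximal_inequality D c _ m hD Dc _ lam0 cm.
    exists B; split => //.
      by rewrite mulfK// in PB; rewrite expf_neq0// gt_eqF.
    move=> w nsw; apply: sB => /=; apply: contrapT => h; apply: nsw; exists m => k.
    by rewrite ltNge; apply/negP => lamk; apply: h; exists k.
  have [B hB] := choice bad.
  (* The intersection has measure at most [1/(i+1)] for every [i], hence is null. *)
  exists (\bigcap_i B i); split.
  - by apply: bigcapT_measurable => i; case: (hB i).
  - apply/eqP; rewrite eq_le measure_ge0 andbT.
    apply/lee_addgt0Pr => e e0; rewrite add0e.
    have [i ie] : exists i : nat, i.+1%:R^-1 < e.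
      by have [i] := ltr_add_invr e0; rewrite add0r; exists i.
    apply: (@le_trans _ _ (P (B i))).
      apply: le_measure; rewrite ?inE//.
      + by apply: bigcapT_measurable => k; case: (hB k).
      + by case: (hB i).
      + exact: bigcap_inf.
    by case: (hB i) => _ /le_trans h _; apply: h; rewrite lee_fin ltW.
  - by move=> w nsw i _; case: (hB i) => _ _; exact.
apply: filterS smallP => w smw.
apply/cauchy_cvgP/cauchy_seriesP => e e0.
have [j je] : exists j : nat, j.+1%:R^-1 < e / 2.
  have e20 : 0 < e / 2 by rewrite divr_gt0.
  by have [i] := ltr_add_invr e20; rewrite add0r; exists i.
have [m sm] := smw j.
have psum p : (m <= p)%N -> `|\sum_(m <= i < p) D i w| < e / 2.
  by move=> mp; rewrite -(subnKC mp) sum_nat_shift (lt_trans (sm _) je).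
near=> pq.
have mp : (m <= pq.1)%N.
  near: pq; exists ([set p | (m <= p)%N], setT) => /=; last by move=> [? ?] [].
  by split; [exists m|exact: filterT].
have mq : (m <= pq.2)%N.
  near: pq; exists (setT, [set p | (m <= p)%N]) => /=; last by move=> [? ?] [].
  by split; [exact: filterT|exists m].
(* A block is a difference of two sums starting at [m], each below [e / 2]; with its ends reversed
   it is empty. *)
have [pq12|/ltnW pq21] := leqP pq.1 pq.2; last first.
  by rewrite big_geq// normr0.
have -> : \sum_(pq.1 <= k < pq.2) D k w =
    \sum_(m <= k < pq.2) D k w - \sum_(m <= k < pq.1) D k w.
  by rewrite (big_cat_nat mp pq12)/= addrAC subrr add0r.
by rewrite (splitr e) (le_lt_trans (ler_normB _ _))// ltrD// psum.
Unshelve. all: by end_near. Qed.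

End martingale_series.

(** * Measurability of the iterates *)

Section borel_row_vectors.
Context {R : realType} {n : nat}.

Lemma continuous_measurable_borel_rV (h : 'rV[R]_n -> R) : continuous h ->
  measurable_fun [set: borel_rV R n] h.
Proof.
move=> ch.
apply: (measurability _ (RGenOpens.measurableE R)).
move=> _ [_ [a [b ->] <-]]; rewrite setTI; apply: sub_sigma_algebra.
by apply: open_comp => //; exact: interval_open.
Qed.

Lemma measurable_coord_borel_rV (i : 'I_n) :
  measurable_fun [set: borel_rV R n] (fun y : borel_rV R n => y ord0 i).
Proof. by apply: continuous_measurable_borel_rV => y; exact: coord_continuous. Qed.

(** A countable base. These balls are boxes, as the norm is the maximum norm, so their preimages are
    finite intersections of coordinate preimages. *)
Let rat_ball (qk : 'rV[rat]_n * nat) : set 'rV[R]_n :=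
  ball (map_mx ratr qk.1 : 'rV[R]_n) qk.2.+1%:R^-1.

(** Balls not contained in [U] are replaced by the empty set, which keeps the index type
    countable. *)
Lemma open_bigcup_rat_ball (U : set 'rV[R]_n) : open U ->
  U = \bigcup_qk (if `[< rat_ball qk `<=` U >] then rat_ball qk else set0).
Proof.
move=> oU; apply/seteqP; split => [y Uy|y [qk _]]; last first.
  by case: ifPn => // /asboolP; exact.
have /nbhs_ballP[e /= e0 yeU] := open_nbhs_nbhs (conj oU Uy).
have [k ke] : exists k : nat, k.+1%:R^-1 < e / 2.
  have e20 : 0 < e / 2 by rewrite divr_gt0.
  by have [i] := ltr_add_invr e20; rewrite add0r; exists i.
have k0 : 0 < k.+1%:R^-1 :> R by rewrite invr_gt0.
have qP (i : 'I_n) : exists q : rat, `|y ord0 i - ratr q| < k.+1%:R^-1.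
  have [|q] := @rat_in_itvoo R (y ord0 i - k.+1%:R^-1) (y ord0 i + k.+1%:R^-1).
    by rewrite ltrD2l gtrN.
  rewrite in_itv/= => /andP[q1 q2]; exists q; rewrite ltr_distlC.
  by apply/andP.
have [q hq] := choice qP.
pose Q : 'rV[rat]_n := \row_i q i.
have yQ : ball (map_mx ratr Q : 'rV[R]_n) k.+1%:R^-1 y.
  split => // i j; rewrite !mxE ord1 -ball_normE /ball_/= distrC; exact: hq.
exists (Q, k) => //.
case: ifPn => [//|/asboolP]; case => z Qz.
apply: yeU; rewrite (splitr e); apply: ball_triangle; last exact: le_ball (ltW ke) _ Qz.
by apply: ball_sym; exact: le_ball (ltW ke) _ yQ.
Qed.

Lemma measurable_fun_borel_rV {d} {T : measurableType d} (h : T -> 'rV[R]_n) :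
  (forall i, measurable_fun setT (fun w => h w ord0 i)) ->
  measurable_fun setT (h : T -> borel_rV R n).
Proof.
move=> mh; apply: (@measurability _ _ T (borel_rV R n) _ _ (@open 'rV[R]_n)) => // _ [U oU <-].
rewrite setTI (open_bigcup_rat_ball _ oU) preimage_bigcup.
apply: countable_bigcupT_measurable => [|qk].
  exact: countableP.
case: ifPn => _; last by rewrite preimage_set0.
rewrite (_ : _ @^-1` _ =
    \bigcap_(i in @setT 'I_n) ((fun w => h w ord0 i) @^-1`
      ball (ratr (qk.1 ord0 i) : R) qk.2.+1%:R^-1)).
  apply: fin_bigcap_measurable; first exact: finite_finset.
  by move=> i _; rewrite -[X in measurable X]setTI; apply: mh => //; exact: measurable_ball.
apply/seteqP; split => [w [_ hw] i _|w hw].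
  by have := hw ord0 i; rewrite mxE.
split=> [|i j]; first by rewrite invr_gt0.
by rewrite ord1 mxE; exact: hw.
Qed.

Lemma measurable_enorm {d} {T : measurableType d} (h : T -> 'rV[R]_n) :
  (forall i, measurable_fun setT (fun w => h w ord0 i)) ->
  measurable_fun setT (fun w => enorm (h w)).
Proof.
move=> mh; apply: (measurableT_comp (continuous_measurable_fun (@sqrt_continuous R))).
by apply: measurable_sum => i; exact: measurable_funX.
Qed.

End borel_row_vectors.

(** On nonnegative reals the inverse is the power [-1], also at 0, where both are 0 by convention;
    measurability of [powR] then applies. *)
Lemma measurable_fun_inv_ge0 {d} {T : measurableType d} {R : realType} (h : T -> R) :
  (forall w, 0 <= h w) -> measurable_fun setT h ->
  measurable_fun setT (fun w => (h w)^-1).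
Proof.
move=> h0 mh.
rewrite (_ : (fun w => _) = (fun w => h w `^ (-1))).
  exact: (measurableT_comp (@measurable_powR R (-1)) mh).
by apply/funext => w; rewrite powR_inv1.
Qed.

Lemma measurable_oracle {dO dE} {Omega : measurableType dO} {E : measurableType dE}
    {R : realType} {n : nat} {P : probability Omega R} {xi : nat -> {RV P >-> E}}
    {g : 'rV[R]_n -> E -> 'rV[R]_n} {y : Omega -> 'rV[R]_n} :
  measurable_fun [set: borel_rV R n * E]
    (fun p : borel_rV R n * E => g p.1 p.2 : borel_rV R n) ->
  forall t, (forall i, measurable_fun [set: past xi t] (fun w => y w ord0 i)) ->
  forall i, measurable_fun [set: past xi t.+1] (fun w => g (y w) (xi t w) ord0 i).
Proof.
move=> mg t my i; apply: (measurableT_comp (measurable_coord_borel_rV i)).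
apply: (measurableT_comp mg (g := fun w : past xi t.+1 => (y w : borel_rV R n, xi t w))).
apply: measurable_fun_pair; last exact: measurable_xi_past.
by apply: measurable_fun_borel_rV => j; exact: past_le (leqnSn t) (my j).
Qed.

Section oracle_noise.
Context {dO dE} {Omega : measurableType dO} {E : measurableType dE} {R : realType}.
Context {n : nat} (P : probability Omega R) (xi : nat -> {RV P >-> E}).
Variables (f : 'rV[R]_n -> R) (g : 'rV[R]_n -> E -> 'rV[R]_n).
Variable x : nat -> Omega -> 'rV[R]_n.
Hypothesis mg : measurable_fun [set: borel_rV R n * E]
  (fun p : borel_rV R n * E => g p.1 p.2 : borel_rV R n).
Hypothesis mgrad : continuous (grad f).
Hypothesis gmean : forall t y, has_mean P (fun w => g y (xi t w)) (grad f y).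
Hypothesis indep : mutually_independent xi.
Hypothesis mx : forall t i, measurable_fun [set: past xi t] (fun w => x t w ord0 i).

Lemma measurable_grad_iterate t i :
  measurable_fun [set: past xi t] (fun w => grad f (x t w) ord0 i).
Proof.
have mgi : measurable_fun [set: borel_rV R n] (fun y => grad f y ord0 i).
  apply: continuous_measurable_borel_rV => y.
  apply: (@continuous_comp _ _ _ (grad f) (fun M => M ord0 i)); first exact: mgrad.
  exact: coord_continuous.
by apply: (measurableT_comp mgi); apply: measurable_fun_borel_rV => j; exact: mx.
Qed.

(** The weight [W] will be the step size, alone or times a gradient coordinate. With the past
    frozen, only [xi t] is random, and unbiasedness of the oracle makes the integral vanish. *)
Lemma noise_martingale_difference (i : 'I_n) (W : nat -> Omega -> R) :
  (forall t, measurable_fun [set: past xi t] (W t)) ->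
  martingale_difference P xi
    (fun t w => W t w * (g (x t w) (xi t w) ord0 i - grad f (x t w) ord0 i)).
Proof.
move=> mW; split=> [t|t Z mZ iZ].
  apply: measurable_funM; first exact: past_le (leqnSn t) (mW t).
  apply: measurable_funB; first exact: measurable_oracle mg t (mx t) i.
  exact: past_le (leqnSn t) (measurable_grad_iterate t i).
(* The identity into the coarser sigma-algebra serves as the random variable that carries the whole
   past. *)
have mid : measurable_fun [set: Omega] (fun w => w : past xi t).
  by move=> _ A mA; rewrite setTI; exact: measurable_past mA.
pose Y : {RV P >-> past xi t} := mfun_Sub (mem_set mid).
pose h (p : past xi t * E) : \bar R :=
  (Z p.1 * (W t p.1 * (g (x t p.1) p.2 ord0 i - grad f (x t p.1) ord0 i)))%:E.
have mfst (k : Omega -> R) : measurable_fun [set: past xi t] k ->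
    measurable_fun [set: past xi t * E] (fun p : past xi t * E => k p.1).
  by move=> mk; exact: (measurableT_comp mk (@measurable_fst _ _ _ _)).
have slope y e : h (y, e) = ((Z y * W t y)%:E *
    ((g (x t y) e ord0 i)%:E - (grad f (x t y) ord0 i)%:E))%E.
  by rewrite /h/= mulrA EFinM EFinB.
have icst w : P.-integrable setT (fun=> (grad f (x t w) ord0 i)%:E).
  exact: finite_measure_integrable_cst.
apply: (@integral_independent0 _ _ _ _ _ _ _ P Y (xi t) h).
- by move=> A B mA mB; exact: past_independent.
- apply/measurable_EFinP; apply: measurable_funM; first exact: mfst.
  apply: measurable_funM; first exact: mfst.
  apply: measurable_funB; last exact: mfst (measurable_grad_iterate t i).
  apply: (measurableT_comp (measurable_coord_borel_rV i)).
  apply: (measurableT_comp mg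
    (g := fun p : past xi t * E => (x t p.1 : borel_rV R n, p.2))).
  apply: measurable_fun_pair; last exact: measurable_snd.
  by apply: measurable_fun_borel_rV => j; exact: mfst (mx t j).
- exact: iZ.
- move=> y; under eq_fun do rewrite slope.
  apply: integrableZl => //; apply: integrableB => //.
  exact: (gmean t (x t y) i).1.
- move=> y; under eq_integral do rewrite slope.
  have [ig Eg] := gmean t (x t y) i.
  rewrite integralZl//; last exact: integrableB.
  have intE : (\int[P]_w (grad f (x t y) ord0 i)%:E = (grad f (x t y) ord0 i)%:E)%E.
    by rewrite -[RHS]mule1 -(probability_setT P) -integral_cst.
  rewrite integralB//= intE.
  by rewrite unlock in Eg; rewrite Eg subee// mule0.
Qed.

End oracle_noise.

(** [v_t] involves only the oracle outputs before time [t]; this delay makes the step size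
    measurable with respect to [past t] and independent of [xi t]. *)
Lemma adam_measurable {dO dE} {Omega : measurableType dO} {E : measurableType dE}
    {R : realType} {n : nat} (P : probability Omega R) (xi : nat -> {RV P >-> E})
    (g : 'rV[R]_n -> E -> 'rV[R]_n) (beta beta' kappa eps : R) (x0 : 'rV[R]_n)
    (v : nat -> Omega -> R) (m x : nat -> Omega -> 'rV[R]_n) :
  measurable_fun [set: borel_rV R n * E]
    (fun p : borel_rV R n * E => g p.1 p.2 : borel_rV R n) ->
  0 < kappa ->
  (forall w, perturbed_adam beta beta' kappa eps x0
    (fun t => g (x t w) (xi t w)) (v ^~ w) (m ^~ w) (x ^~ w)) ->
  forall t, [/\ measurable_fun [set: past xi t] (v t),
    forall i, measurable_fun [set: past xi t] (fun w => m t w ord0 i) &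
    forall i, measurable_fun [set: past xi t] (fun w => x t w ord0 i)].
Proof.
move=> mg kappa0 adam; elim => [|t [mv mm mx]].
  split=> [|i|i].
  - rewrite (_ : v 0%N = cst 0); first exact: measurable_cst.
    by apply/funext => w; exact: adam_v0 (adam w).
  - rewrite (_ : (fun w => _) = cst 0); first exact: measurable_cst.
    by apply/funext => w; rewrite (adam_m0 (adam w)) mxE.
  - rewrite (_ : (fun w => _) = cst (x0 ord0 i)); first exact: measurable_cst.
    by apply/funext => w; rewrite (adam_x0 (adam w)).
have up (k : Omega -> R) : measurable_fun [set: past xi t] k ->
    measurable_fun [set: past xi t.+1] k by exact: past_le.
have mgt i : measurable_fun [set: past xi t.+1] (fun w => g (x t w) (xi t w) ord0 i).
  exact: measurable_oracle mg t mx i.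
have mmS i : measurable_fun [set: past xi t.+1] (fun w => m t.+1 w ord0 i).
  rewrite (_ : (fun w => _) = (fun w => beta * m t w ord0 i -
      (1 - beta) * (t.+1%:R `^ (1 / 2 + eps))^-1 * (kappa + Num.sqrt (v t w))^-1 *
        g (x t w) (xi t w) ord0 i)); last first.
    by apply/funext => w; rewrite (adam_m (adam w)) !mxE invfM mulrA.
  apply: measurable_funB; first by apply: measurable_funM => //; exact: up.
  apply: measurable_funM => //; apply: measurable_funM => //.
  apply: measurable_fun_inv_ge0.
    by move=> w; rewrite addr_ge0 ?sqrtr_ge0// ltW.
  apply: measurable_funD => //.
  exact: (measurableT_comp (continuous_measurable_fun (@sqrt_continuous R)) (up _ mv)).
split=> // [|i].
  rewrite (_ : v t.+1 = (fun w => beta' * v t w +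
      (1 - beta') * enorm (g (x t w) (xi t w)) ^+ 2)); last first.
    by apply/funext => w; rewrite (adam_v (adam w)).
  apply: measurable_funD; apply: measurable_funM => //; first exact: up.
  by apply: measurable_funX; exact: measurable_enorm.
rewrite (_ : (fun w => _) = (fun w => x t w ord0 i + m t.+1 w ord0 i)); last first.
  by apply/funext => w; rewrite (adam_x (adam w)) mxE.
by apply: measurable_funD => //; exact: up.
Qed.

(** * The perturbed Adam iteration *)

Theorem corollary3 (R : realType) (n : nat)
    (dO : measure_display) (Omega : measurableType dO) (P : probability Omega R)
    (dE : measure_display) (E : measurableType dE)
    (xi : nat -> {RV P >-> E})
    (f : 'rV[R]_n -> R) (g : 'rV[R]_n -> E -> 'rV[R]_n)
    (alpha beta beta' kappa eps : R) (x0 : 'rV[R]_n)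
    (v : nat -> Omega -> R) (m x : nat -> Omega -> 'rV[R]_n)
    (hg : measurable_fun [set: borel_rV R n * E]
            (fun p : borel_rV R n * E => g p.1 p.2 : borel_rV R n))
    (* A.1 *)
    (hC1 : C1 f)
    (hinf : (-oo < ereal_inf (range (EFin \o f)))%E)
    (* A.2 *)
    (halpha : 0 < alpha <= 1)
    (hholder : exists2 A : R, 0 < A &
       forall y z, enorm (grad f y - grad f z) <= A * enorm (y - z) `^ alpha)
    (* A.3 *)
    (hmean : forall t y, has_mean P (fun w => g y (xi t w)) (grad f y))
    (* A.5 *)
    (hindep : mutually_independent xi)
    (hbeta : 0 <= beta < 1) (hbeta' : 0 <= beta' < 1) (hkappa : 0 < kappa)
    (hadam : forall w, perturbed_adam beta beta' kappa eps x0
       (fun t => g (x t w) (xi t w)) (v ^~ w) (m ^~ w) (x ^~ w))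
    (heps : 1 / (1 + alpha) - 1 / 2 < eps <= 1 / 2)
    (hbound : exists2 G : R, 0 < G &
       {ae P, forall w, forall t,
          enorm (grad f (x t w)) <= G /\ enorm (g (x t w) (xi t w)) <= G}) :
  [/\ {ae P, forall w, grad f (x t w) @[t --> \oo] --> (0 : 'rV[R]_n)},
      {ae P, forall w, cvg (f (x t w) @[t --> \oo])} &
      {ae P, forall w,
         limn_einf (fun t : nat =>
           (t%:R `^ (1 / 2 - eps) * enorm (grad f (x t w)) ^+ 2)%:E) = 0%E}].
Proof.
have [A A0 holder] := hholder.
have [G G0 bound] := hbound.
have [alpha0 alpha1] := andP halpha.
have [eps1 eps2] := andP heps.
have [beta'0 beta'1] := andP hbeta'.
(* The lower bound on [eps] says [p (1 + alpha) > 1], for the descent errors; with [alpha <= 1] it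
   gives [2 p > 1], for the noise. The upper bound says [p <= 1], for divergence of the step
   sizes. *)
pose p := 1 / 2 + eps; pose q := 1 + alpha.
have q0 : 0 < q by rewrite /q; lra.
have pq : 1 < p * q.
  by rewrite -ltr_pdivrMr// /p /q -ltrBlDl.
have p0 : 0 < p by rewrite -(pmulr_lgt0 _ q0) (lt_trans _ pq).
have p2 : 1 < p * 2 by rewrite (lt_le_trans pq)// ler_pM2l// /q; lra.
have p1 : p <= 1 by rewrite /p; lra.
pose gam (t : nat) : R := t.+1%:R `^ (- p).
have gam0 t : 0 <= gam t by exact: powR_ge0.
have cvg_gam r : 1 < p * r -> cvgn (series (fun t => gam t `^ r)).
  move=> pr; rewrite (_ : (fun t => _) = (fun t => t.+1%:R `^ (- (p * r)))).
    exact: cvg_series_powR.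
  by apply/funext => t; rewrite /gam -powRrM mulNr.
(* Comparable to [gam t]: the upper bound [a_le] holds everywhere, the lower bound [a_ge] on the
   event [good]. *)
pose a (t : nat) w := (t.+1%:R `^ p * (kappa + Num.sqrt (v t w)))^-1.
have den0 t w : 0 < kappa + Num.sqrt (v t w) by rewrite ltr_wpDr// sqrtr_ge0.
have aE t w : a t w = gam t / (kappa + Num.sqrt (v t w)).
  by rewrite /a invfM /gam powRN.
have a0 t w : 0 <= a t w by rewrite aE divr_ge0// ltW.
have a_le t w : a t w <= kappa^-1 * gam t.
  by rewrite aE mulrC ler_wpM2r// lef_pV2 ?posrE// lerDl sqrtr_ge0.
have cvg_aq w : cvgn (series (fun t => a t w `^ q)).
  apply: (@series_le_cvg _ _ (fun t => kappa^-1 `^ q * gam t `^ q)) => [t|t|t|].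
  - exact: powR_ge0.
  - by rewrite mulr_ge0// powR_ge0.
  - rewrite -powRM ?invr_ge0 ?(ltW hkappa)//.
    by rewrite ge0_ler_powR ?nnegrE ?(ltW q0)// mulr_ge0// invr_ge0 ltW.
  - exact: (@is_cvg_seriesZ _ _ (kappa^-1 `^ q) (cvg_gam _ pq)).
have cvg_sqr_gam C : cvgn (series (fun t => (C * gam t) ^+ 2)).
  rewrite (_ : (fun t => _) = (fun t => C ^+ 2 * gam t `^ 2)).
    exact: (@is_cvg_seriesZ _ _ (C ^+ 2) (cvg_gam _ p2)).
  by apply/funext => t; rewrite exprMn powR_mulrn.
have meas := adam_measurable P xi g beta beta' kappa eps x0 v m x hg hkappa hadam.
have mx t i : measurable_fun [set: past xi t] (fun w => x t w ord0 i).
  by have [_ _] := meas t.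
have ma t : measurable_fun [set: past xi t] (a t).
  have [mv _ _] := meas t.
  apply: measurable_fun_inv_ge0.
    by move=> w; rewrite mulr_ge0 ?powR_ge0// ltW.
  apply: measurable_funM => //; apply: measurable_funD => //.
  exact: (measurableT_comp (continuous_measurable_fun (@sqrt_continuous R)) mv).
have mgrad := measurable_grad_iterate P xi f x hC1.2 mx.
have noise_le w t i : enorm (grad f (x t w)) <= G -> enorm (g (x t w) (xi t w)) <= G ->
    `|g (x t w) (xi t w) ord0 i - grad f (x t w) ord0 i| <= G + G.
  move=> fG gG; rewrite (le_trans (ler_normB _ _))// lerD//.
    exact: le_trans (coord_le_enorm _ _) gG.
  exact: le_trans (coord_le_enorm _ _) fG.
have noise_cvg i : {ae P, forall w, cvgn (series (fun t =>
    a t w * (g (x t w) (xi t w) ord0 i - grad f (x t w) ord0 i)))}.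
  apply: (martingale_series_cvg P xi _ (fun t => (kappa^-1 * (G + G)) * gam t)).
  - exact: (noise_martingale_difference P xi f g x hg hC1.2 hmean hindep mx i a).
  - apply: filterS bound => w bw t; have [fG gG] := bw t.
    rewrite normrM ger0_norm// mulrAC.
    by rewrite ler_pM// noise_le.
  - exact: cvg_sqr_gam.
have grad_noise_cvg i : {ae P, forall w, cvgn (series (fun t =>
    a t w * grad f (x t w) ord0 i *
      (g (x t w) (xi t w) ord0 i - grad f (x t w) ord0 i)))}.
  apply: (martingale_series_cvg P xi _ (fun t => (kappa^-1 * (G * (G + G))) * gam t)).
  - apply: (noise_martingale_difference P xi f g x hg hC1.2 hmean hindep mx i
      (fun t w => a t w * grad f (x t w) ord0 i)).
    by move=> t; apply: measurable_funM.
  - apply: filterS bound => w bw t; have [fG gG] := bw t.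
    rewrite !normrM ger0_norm//.
    have -> : kappa^-1 * (G * (G + G)) * gam t = kappa^-1 * gam t * G * (G + G).
      by ring.
    rewrite ler_pM ?mulr_ge0 ?noise_le// ler_pM//.
    exact: le_trans (coord_le_enorm _ _) fG.
  - exact: cvg_sqr_gam.
(* The almost sure event on which the pathwise results apply. *)
pose good w := [/\ forall t, enorm (grad f (x t w)) <= G,
  forall t, enorm (g (x t w) (xi t w)) <= G,
  forall i, cvgn (series (fun t =>
    a t w * (g (x t w) (xi t w) ord0 i - grad f (x t w) ord0 i))) &
  forall i, cvgn (series (fun t => a t w * grad f (x t w) ord0 i *
      (g (x t w) (xi t w) ord0 i - grad f (x t w) ord0 i)))].
have goodP : {ae P, forall w, good w}.
  have nc : {ae P, forall w, forall i, cvgn (series (fun t =>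
      a t w * (g (x t w) (xi t w) ord0 i - grad f (x t w) ord0 i)))}.
    exact: filter_forall.
  have gc : {ae P, forall w, forall i, cvgn (series (fun t =>
      a t w * grad f (x t w) ord0 i *
      (g (x t w) (xi t w) ord0 i - grad f (x t w) ord0 i)))}.
    exact: filter_forall.
  move: bound nc gc; apply: filterS3 => w bw ncw gcw.
  by split=> // t; have [] := bw t.
have [L fL] : exists L, forall y, L <= f y.
  have inf_le y : (ereal_inf (range (EFin \o f)) <= (f y)%:E)%E.
    by apply: ereal_inf_lbound; exists y.
  (* The value [-oo] is excluded by hypothesis, and [+oo] by the finite value of [f] at [x0]. *)
  case E0 : (ereal_inf (range (EFin \o f))) hinf inf_le => [r| |] // _ inf_le.
    by exists r => y; have := inf_le y; rewrite lee_fin.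
  by have := inf_le x0.
have mS w t : m t.+1 w = beta *: m t w - ((1 - beta) * a t w) *: g (x t w) (xi t w).
  by rewrite (adam_m (hadam w)).
(* Each update is a convex combination of the previous value and a squared norm, both at most
   [G^2]. *)
have v_bound w t : good w -> 0 <= v t w <= G ^+ 2.
  case=> _ gG _ _; elim: t => [|t /andP[IH0 IH]].
    by rewrite (adam_v0 (hadam w)) lexx sqr_ge0.
  rewrite (adam_v (hadam w)); apply/andP; split.
    by rewrite addr_ge0// mulr_ge0 ?sqr_ge0// subr_ge0 ltW.
  have gG2 : enorm (g (x t w) (xi t w)) ^+ 2 <= G ^+ 2.
    by rewrite lerXn2r ?nnegrE ?enorm_ge0// ltW.
  have -> : G ^+ 2 = beta' * G ^+ 2 + (1 - beta') * G ^+ 2 by ring.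
  by rewrite lerD// ler_wpM2l// subr_ge0 ltW.
have a_ge w t : good w -> (kappa + G)^-1 * gam t <= a t w.
  move=> gw; have /andP[v0 vG] := v_bound w t gw.
  rewrite aE mulrC ler_wpM2l// lef_pV2 ?posrE//; last by rewrite addr_gt0.
  by rewrite lerD2l -(ger0_norm (ltW G0)) -sqrtr_sqr ler_wsqrtr.
have dva w : good w -> ~ cvgn (series (a ^~ w)).
  move=> gw cva; apply: (@dvg_harmonic R).
  apply: (@series_le_cvg _ _ (fun t => (kappa + G) * a t w)) => [t|t|t|].
  - exact: harmonic_ge0.
  - by rewrite mulr_ge0// addr_ge0// ltW.
  - apply: (@le_trans _ _ (gam t)).
      rewrite /harmonic/= -powR_inv1// /gam.
      by rewrite ler_powR ?ler1n// lerN2.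
    by rewrite -ler_pdivrMl ?a_ge// addr_gt0.
  - exact: (@is_cvg_seriesZ _ _ (kappa + G) cva).
split.
- apply: filterS goodP => w gw; have [fG gG nc gc] := gw.
  apply: (cvg_enorm0 (fun t => grad f (x t w))).
  exact: (grad_cvg0 f A alpha beta L G (x ^~ w) (m ^~ w)
    (fun t => g (x t w) (xi t w)) (a ^~ w) hC1.1 A0 holder alpha0 hbeta fL
    (adam_m0 (hadam w)) (mS w) (adam_x (hadam w)) (a0^~ w) (cvg_aq w) gG nc gc
    (dva w gw)).
- apply: filterS goodP => w gw; have [fG gG nc gc] := gw.
  exact: (cvg_cost f A alpha beta L G (x ^~ w) (m ^~ w)
    (fun t => g (x t w) (xi t w)) (a ^~ w) hC1.1 A0 holder alpha0 hbeta fL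
    (adam_m0 (hadam w)) (mS w) (adam_x (hadam w)) (a0^~ w) (cvg_aq w) fG gG gc).
- apply: filterS goodP => w gw; have [fG gG nc gc] := gw.
  have -> : 1 / 2 - eps = 1 - p by rewrite /p; lra.
  apply: (@weighted_series_einf0 _ (a ^~ w) _ (kappa + G)^-1) => //.
  + by rewrite invr_gt0 addr_gt0.
  + by move=> t; exact: sqr_ge0.
  + by move=> t; exact: a_ge.
  exact: (cvg_series_sqr_grad f A alpha beta L G (x ^~ w) (m ^~ w)
    (fun t => g (x t w) (xi t w)) (a ^~ w) hC1.1 A0 holder alpha0 hbeta fL
    (adam_m0 (hadam w)) (mS w) (adam_x (hadam w)) (a0^~ w) (cvg_aq w) gG gc).
Qed.
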